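(* Let $\Gamma$ be an oriented graph in which every vertex has exactly $g$ outgoing edges, let $D\subset\Gamma$ be a subgraph whose Green's function is finite, and let $F_1,F_2$ be two disjoint finite sets of vertices of $D$. Consider the soup of oriented unrooted loops in $D$ with intensity $\alpha=1$ (a Poisson point process with intensity $\mu$). Let $\eta=(\eta_1,\dots,\eta_{\mathcal N})$ be the collection of all excursions away from $F_2$ that reach $F_1$, of the loops of the soup that intersect both $F_1$ and $F_2$; let $\mathcal Y=(\mathcal Y_1,\dots,\mathcal Y_{\mathcal N})$ and $\mathcal X=(\mathcal X_1,\dots,\mathcal X_{\mathcal N})$ be the vectors of starting points and of endpoints of these excursions (all lying in $F_2$), and let $\beta$ be the unordered bridge from $\mathcal X$ to $\mathcal Y$ in $D\setminus F_1$ formed by the missing parts of these loops. Then the conditional distribution of $\beta$ given $\eta$ is exactly the unordered bridge measure $B^{D\setminus F_1}_{\mathcal X,\mathcal Y}$.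
   Context: **Graph, loops.** $\Gamma$ is a discrete oriented graph; parallel edges and edges from a vertex to itself are allowed, and there may be an edge from $x$ to $y$ but none from $y$ to $x$. A rooted loop with $n=|l|\ge 1$ steps is $l=(l_0,e_1,l_1,\dots,e_n,l_n)$ with $l_0=l_n$ and $e_i$ an edge from $l_{i-1}$ to $l_i$ (so the edges used are part of the information). Put $p(l)=g^{-n}$ and $\rho(l)=p(l)/n$. An unrooted (oriented) loop is an equivalence class of rooted loops modulo rerooting (cyclic shift). The measure $\mu$ on unrooted oriented loops in $D$ is the image of $\rho$, restricted to loops in $D$, under the map sending a rooted loop to its class. Equivalently $\mu(L)=p(l)/J(l)$ for $l\in L$, where $J(l)$ is the maximal $J$ such that $l$ is the concatenation of $J$ copies of the same loop. The loop-soup with intensity $\alpha$ is a Poisson point process of unrooted loops with intensity $\alpha\mu$. **Bridges.** For a subgraph $D'$ and vertices $x,y$ of $D'$, a bridge $b$ from $x$ to $y$ in $D'$ is a finite nearest-neighbour path in $D'$ from $x$ to $y$ (keeping track of the oriented edges used); $n(b)$ is its number of steps, and $n(b)=0$ is allowed if $x=y$. The Green's function is $G_{D'}(x,y)=\sum_b g^{-n(b)}$, summed over all bridges from $x$ to $y$ in $D'$; ''the Green's function of $D$ is finite'' means $G_D(x,y)<\infty$ for all $x,y$ in $D$. If $G_{D'}(x,y)>0$, the bridge probability measure gives mass $g^{-n(b)}/G_{D'}(x,y)$ to each bridge $b$. For $X=(x_1,\dots,x_N)$, $Y=(y_1,\dots,y_N)$, an unordered bridge from $X$ to $Y$ in $D'$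 is a permutation $s$ of $\{1,\dots,N\}$ together with bridges $b^j$ from $x_j$ to $y_{s(j)}$ in $D'$, $j=1,\dots,N$. The unordered bridge measure $B^{D'}_{X,Y}$ is the probability measure obtained by first sampling $\sigma$ with $P(\sigma=s)$ proportional to $\prod_{j=1}^N G_{D'}(x_j,y_{s(j)})$, and then, given $\sigma$, sampling independent bridges from $x_j$ to $y_{\sigma(j)}$ in $D'$ according to the bridge probability measures. Equivalently, each unordered bridge has probability proportional to $g^{-K}$, with $K$ the total length of its $N$ bridges. (It is defined when $\prod_j G_{D'}(x_j,y_{s(j)})>0$ for some $s$.) $D\setminus F_1$ is $D$ with the vertices of $F_1$ removed. **Excursions and missing parts.** Let $\overline{\mathcal L}$ be the (a.s. finite) family, with multiplicities, of the loops of the soup that intersect both $F_1$ and $F_2$. The excursions of such a loop away from $F_2$ reaching $F_1$ are its portions $(a_0,e_1,a_1,\dots,e_k,a_k)$ with $a_0,a_k\in F_2$, $\{a_1,\dots,a_{k-1}\}\cap F_2=\emptyset$ and at least one $a_i\in F_1$ ($a_0=a_k$ is allowed, and the excursion may be the whole loop, if the loop visits $F_2$ only once). $\eta$ is the list of all such excursions of all loops in $\overline{\mathcal L}$, counted with multiplicity, ordered by a fixed deterministic rule. Removing the excursions from the loops of $\overline{\mathcal L}$ leaves $\mathcal N$ paths (possibly of length zero) in $D\setminus F_1$, each joining the endpoint $\mathcal X_j$ of an excursion $\eta_j$ to the starting point $\mathcal Y_{\sigma(j)}$ of the next one on the same loop, $\sigma$ being a permutation; $\beta$ is the unordered bridge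 consisting of $\sigma$ and these paths. When some excursions in $\eta$ coincide, $\beta$ is only determined up to relabelling identical excursions; it is then chosen uniformly at random among all unordered bridges from $\mathcal X$ to $\mathcal Y$ in $D\setminus F_1$ whose concatenation with $\eta$ gives $\overline{\mathcal L}$. *)

(* Defs.v *)
From HB Require Import structures.
From mathcomp Require Import all_boot all_order all_algebra perm.
From mathcomp Require Import finmap multiset generic_quotient.
From mathcomp Require Import all_classical all_reals all_analysis.

Set Implicit Arguments.
Unset Strict Implicit.
Unset Printing Implicit Defensive.

Import Order.TTheory GRing.Theory Num.Theory.

Local Open Scope classical_set_scope.
Local Open Scope ring_scope.

Record digraph := Digraph {
  vert : choiceType;
  edge : choiceType;
  src : edge -> vert;
  tgt : edge -> vert }.

Record subgraph (G : digraph) := Subgraph {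
  sub_vert : set (vert G);
  sub_edge : set (edge G);
  sub_edge_ends : forall e, sub_edge e ->
    sub_vert (src e) /\ sub_vert (tgt e) }.

Definition remove_vertices (G : digraph) (D : subgraph G)
    (F : {fset vert G}) : subgraph G.
Proof.
apply: (@Subgraph G
  [set x | sub_vert D x /\ x \notin F]
  [set e | [/\ sub_edge D e, src e \notin F & tgt e \notin F]]).
by move=> e [/sub_edge_ends[? ?] ? ?].
Defined.

(** The visited vertices of a path are determined by its starting vertex and
    its edges, see [verts]; zero-step paths are [Walk x [::]]. *)
Record walk (G : digraph) := Walk {
  start : vert G;
  wedges : seq (edge G) }.

Section WalkChoice.
Variable G : digraph.
Let walk_pair (w : walk G) := (start w, wedges w).
Let pair_walk (p : vert G * seq (edge G)) := Walk p.1 p.2.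
Let walk_pairK : cancel walk_pair pair_walk. Proof. by case. Qed.
HB.instance Definition _ := Choice.copy (walk G) (can_type walk_pairK).
End WalkChoice.

Section Walks.
Variable G : digraph.
Implicit Types (w l : walk G) (D : subgraph G) (F : {fset vert G}).

Definition steps w : nat := size (wedges w).
Definition verts w : seq (vert G) := start w :: [seq tgt e | e <- wedges w].
Definition finish w : vert G := last (start w) [seq tgt e | e <- wedges w].

(** The [i]-th edge leaves from the [(i-1)]-st vertex. *)
Definition is_walk w : bool :=
  [seq src e | e <- wedges w] == belast (start w) [seq tgt e | e <- wedges w].

Definition meets F w : bool := has (fun x => x \in F) (verts w).

Definition in_subgraph D w : Prop :=
  (forall x, x \in verts w -> sub_vert D x) /\
  (forall e, e \in wedges w -> sub_edge D e).

Definition bridges D (x y : vert G) : set (walk G) :=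
  [set w | [/\ is_walk w, start w = x, finish w = y & in_subgraph D w]].

Definition is_loop l : bool :=
  [&& is_walk l, (0 < steps l)%N & finish l == start l].

Definition vert_at l (i : nat) : vert G := nth (start l) (verts l) i.

Definition reroot (i : nat) l : walk G := Walk (vert_at l i) (rot i (wedges l)).

End Walks.

Record rooted_loop (G : digraph) := RootedLoop {
  loop_walk :> walk G;
  loop_walkP : is_loop loop_walk }.

HB.instance Definition _ (G : digraph) := [isSub for @loop_walk G].
HB.instance Definition _ (G : digraph) := [Choice of rooted_loop G by <:].

Section UnrootedLoops.
Variable G : digraph.
Implicit Types l : rooted_loop G.

Definition rerooting : rel (rooted_loop G) := fun l l' =>
  loop_walk l' \in [seq reroot i l | i <- iota 0 (steps l)].

Lemma rerootingP l l' :
  reflect (exists i, wedges l' = rot i (wedges l)) (rerooting l l').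
Proof.
apply: (iffP mapP) => [[i _ ->]|[i e]]; first by exists i.
have start_src (k : rooted_loop G) i0 : (i0 < steps k)%N ->
    vert_at k i0 = nth (start k) [seq src e | e <- wedges k] i0.
  move=> ik; case/and3P: (loop_walkP k) => /eqP -> _ _.
  rewrite /vert_at /verts lastI nth_rcons size_belast size_map.
  by rewrite -/(steps k) ik.
have l0 : (0 < steps l)%N by case/and3P: (loop_walkP l).
have l'0 : (0 < steps l')%N by case/and3P: (loop_walkP l').
wlog il : i e / (i < steps l)%N => [H|].
  have [/H|/rot_oversize r] := ltnP i (steps l); first exact.
  by apply: (H 0%N) => //; rewrite e r rot0.
exists i; first by rewrite mem_iota.
have s : start l' = vert_at l i.
  rewrite start_src // -[LHS]/(vert_at l' 0) start_src // e map_rot.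
  rewrite /rot nth_cat size_drop size_map subn_gt0 il nth_drop addn0.
  by apply: set_nth_default; rewrite size_map.
by case: (loop_walk l') e s => x s /= -> ->.
Qed.

Lemma rerooting_refl : reflexive rerooting.
Proof. by move=> l; apply/rerootingP; exists 0%N; rewrite rot0. Qed.

Lemma rerooting_sym : symmetric rerooting.
Proof.
suff H l l' : rerooting l l' -> rerooting l' l by move=> l l'; apply/idP/idP; apply: H.
move=> /rerootingP[i e]; apply/rerootingP.
by exists (size (wedges l') - i)%N; rewrite -/(rotr i _) e rotK.
Qed.

Lemma rerooting_trans : transitive rerooting.
Proof.
move=> l2 l1 l3 /rerootingP[i e] /rerootingP[j f]; apply/rerootingP.
by rewrite f e rot_rot_add; eexists.
Qed.

Canonical rerooting_equiv :=
  EquivRel rerooting rerooting_refl rerooting_sym rerooting_trans.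

Definition loop : Type := {eq_quot rerooting_equiv}%qT.

HB.instance Definition _ := Choice.on loop.
HB.instance Definition _ := EqQuotient.on loop.

Definition loop_class (l : rooted_loop G) : loop := (\pi_loop l)%qT.
Definition loop_rep (L : loop) : rooted_loop G := repr L.

End UnrootedLoops.

Section PoissonPointProcess.
Context {R : realType} {d : measure_display} {T : measurableType d}.
Variable P : probability T R.
Local Open Scope ereal_scope.

(** [N i w] is the multiplicity of the point [i] in the realization [w]. *)
Definition count_in (I : choiceType) (N : I -> T -> nat) (A : set I) (w : T)
  : \bar R := \esum_(i in A) (N i w)%:R%:E.

(** The law is [poisson_prob] and not [poisson_pmf]: the latter is not the
    Dirac mass at 0 when the rate is 0.  The [0%N] is a dummy argument of
    [poisson_prob]. *)
Definition poisson_point_process (I : choiceType) (mu : set I -> \bar R)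
    (N : I -> T -> nat) : Prop :=
  [/\ forall i k, measurable [set w | N i w = k],
      forall A k, mu A < +oo ->
        measurable [set w | count_in N A w = k%:R%:E] /\
        P [set w | count_in N A w = k%:R%:E]
          = poisson_prob (fine (mu A)) 0%N [set k]
    & forall (n : nat) (A : 'I_n -> set I) (k : 'I_n -> nat),
        (forall i j, i != j -> A i `&` A j = set0) ->
        (forall i, mu (A i) < +oo) ->
        P [set w | forall i, count_in N (A i) w = (k i)%:R%:E]
          = \prod_(i < n) P [set w | count_in N (A i) w = (k i)%:R%:E] ].

(** [K x] is the conditional distribution of [Y] given [X = x], where the value
    spaces carry the discrete sigma-algebra.  With [A := setT] this entails that
    [K (X w)] has total mass 1 for almost every [w]. *)
Definition conditional_distribution (S U : Type) (X : T -> S) (Y : T -> U)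
    (K : S -> set U -> \bar R) : Prop :=
  [/\ forall C : set S, measurable (X @^-1` C),
      forall A : set U, measurable (Y @^-1` A)
    & forall (C : set S) (A : set U),
        P ((X @^-1` C) `&` (Y @^-1` A)) = \int[P]_(w in X @^-1` C) K (X w) A ].

End PoissonPointProcess.

Definition uniform_on {R : realType} (U : choiceType) (S A : set U) : \bar R :=
  ((#|` fset_set (S `&` A)|)%:R / (#|` fset_set S|)%:R)%:E.

Section Measures.
Variables (R : realType) (G : digraph) (g : nat).
Implicit Types D : subgraph G.

Definition weight (w : walk G) : R := g%:R^-1 ^+ steps w.

Definition loop_measure D (A : set (loop G)) : \bar R :=
  \esum_(l in [set l : rooted_loop G | A (loop_class l) /\ in_subgraph D l])
    (weight l / (steps l)%:R)%:E.

Definition green D (x y : vert G) : \bar R :=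
  \esum_(b in bridges D x y) (weight b)%:E.

Definition finite_green D : Prop :=
  forall x y, sub_vert D x -> sub_vert D y -> (green D x y < +oo)%E.

(** Candidate unordered bridges [(s, (b^1, ..., b^n))]; endpoints and the
    ambient subgraph are imposed in [ubridges]. *)
Definition ubridge (n : nat) : Type := ('S_n * {ffun 'I_n -> walk G})%type.

HB.instance Definition _ n := Choice.on (ubridge n).

Definition ubridges D n (X Y : 'I_n -> vert G) : set (ubridge n) :=
  [set b : ubridge n | forall j, bridges D (X j) (Y (b.1 j)) (b.2 j)].

Definition perm_weight D n (X Y : 'I_n -> vert G) (s : 'S_n) : R :=
  \prod_(j < n) fine (green D (X j) (Y (s j))).

Definition perm_prob D n (X Y : 'I_n -> vert G) (s : 'S_n) : R :=
  perm_weight D X Y s / \sum_(s' : 'S_n) perm_weight D X Y s'.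

Definition bridge_prob D (x y : vert G) (w : walk G) : R :=
  if `[< bridges D x y w >] then weight w / fine (green D x y) else 0.

Definition ubridge_prob D n (X Y : 'I_n -> vert G) (b : ubridge n) : R :=
  perm_prob D X Y b.1 *
  \prod_(j < n) bridge_prob D (X j) (Y (b.1 j)) (b.2 j).

Definition ubridge_measure D n (X Y : 'I_n -> vert G) (A : set (ubridge n))
  : \bar R := \esum_(b in A) (ubridge_prob D X Y b)%:E.

End Measures.

Section Excursions.
Variable G : digraph.
Variables F1 F2 : {fset vert G}.

(** The restriction of the soup to the loops meeting [F1] and [F2]; it is the
    empty multiset on the null event where there are infinitely many of them. *)
Definition crossing_loops (c : loop G -> nat) : {mset (loop G)}%mset :=
  [mset[tt] L in fset_set [set L | [/\ meets F1 (loop_rep L),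
                                   meets F2 (loop_rep L) & (0 < c L)%N]]
     => c L]%mset.

Definition is_excursion (a : walk G) : bool :=
  [&& (0 < steps a)%N, start a \in F2, finish a \in F2,
      all (fun e => src e \notin F2) (behead (wedges a)) & meets F1 a].

(** The portion of [k] steps starting at time [i], for [i < steps l] and
    [1 <= k <= steps l]. *)
Definition portion (l : walk G) (i k : nat) : walk G :=
  Walk (vert_at l i) (take k (rot i (wedges l))).

(** Portions are indexed by [(i, k)], hence counted with multiplicity: if the
    loop is a [J]-fold repetition, each of its excursions occurs [J] times. *)
Definition loop_excursions (l : walk G) : seq (walk G) :=
  [seq a <- [seq portion l i k | i <- iota 0 (steps l), k <- iota 1 (steps l)]
     | is_excursion a].

(** Up to the order, this does not depend on the choice of representatives. *)
Definition excursions (m : {mset (loop G)}%mset) : seq (walk G) :=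
  flatten [seq loop_excursions (loop_rep L) | L <- enum_mset m].

Definition exc_start (h : seq (walk G)) (j : 'I_(size h)) : vert G :=
  start (tnth (in_tuple h) j).
Definition exc_finish (h : seq (walk G)) (j : 'I_(size h)) : vert G :=
  finish (tnth (in_tuple h) j).

(** The excursion [h_j], then [b^j], then the excursion [h_(s j)], etc., around
    the cycle of [j] under [s]. *)
Definition loop_through (h : seq (walk G)) (b : ubridge G (size h))
    (j : 'I_(size h)) : walk G :=
  Walk (exc_start j)
    (flatten [seq wedges (tnth (in_tuple h) k) ++ wedges (b.2 k)
             | k <- orbit b.1 j]).

(** One loop for each cycle of the permutation.  The [insub] only fails when
    the concatenated path is not a loop, which does not happen if [b] is an
    unordered bridge from the endpoints to the starting points of [h]. *)
Definition concatenation (h : seq (walk G)) (b : ubridge G (size h))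
  : {mset (loop G)}%mset :=
  seq_mset (pmap (fun j => omap (@loop_class G) (insub (loop_through b j)))
                 (enum (froots b.1))).

Definition some_ubridge : Type := {n : nat & ubridge G n}.

HB.instance Definition _ := Choice.on some_ubridge.

Definition as_ubridge (n : nat) (b : ubridge G n) : some_ubridge :=
  Tagged (fun n => ubridge G n) b.

Definition completions (D : subgraph G) (h : seq (walk G))
    (m : {mset (loop G)}%mset) : set some_ubridge :=
  [set as_ubridge b | b in
    [set b : ubridge G (size h) | ubridges (remove_vertices D F1) (@exc_finish h) (@exc_start h) b /\
             concatenation b = m]].

End Excursions.

(* Main.v *)
Require Import Defs.
From HB Require Import structures.
From mathcomp Require Import all_boot all_order all_algebra perm.
From mathcomp Require Import finmap multiset generic_quotient.
From mathcomp Require Import all_classical all_reals all_analysis.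
From mathcomp Require Import zify ring.

(** Fix a list [h] of excursions.  A realization [m] of the crossing loops with
    excursions [h] has probability [k * w(m) / F(m)], where [w] is the product of
    the weights of the loops, [F(m)] is the product over the distinct loops [L]
    of [J(L) ^ m(L) * m(L)!], and [k] does not depend on [m].  The permutations
    of the indices which preserve [h] act transitively on the unordered bridges
    completing [h] to [m], with stabilizers of order [F(m)]: an automorphism of a
    coloured permutation is determined by the images of one point per cycle.
    Hence there are [c(h) / F(m)] completions of [h] to [m], each of weight
    [w(m) / w(h)], and a uniformly chosen one is an unordered bridge chosen with
    probability proportional to its weight.  That the loops determine the cyclic
    words of excursions and bridges follows from the fact that no excursion
    reaching [F1] starts inside a missing part. *)

Set Implicit Arguments.
Unset Strict Implicit.
Unset Printing Implicit Defensive.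

(** * Decomposition of cyclic words into excursions and bridges *)

(** The cancellation is special to intensity 1. At intensity $\alpha$ the probability of $m$ would
    carry the further factor $\alpha^{|m|}$, where $|m|$ is the number of loops of $m$, that is, the
    number of cycles of the permutation in any completion. This is not a function of the excursions,
    and would bias the law of the permutation. The factor $1/F(m)$ has two sources: $1/J(L)$ in the
    loop measure and $1/m(L)!$ in the Poisson law. On the combinatorial side the same numbers count
    the shifts of a cycle onto itself and the exchanges of cycles that carry the same loop. The
    normalization comes from the converse construction: concatenating $h$ with any unordered bridge
    yields a realization whose excursions are $h$, so that summing over $m$ amounts to summing over
    all unordered bridges. For nonempty $h$ the constant $k$ is $\exp(-\mu(A))$, with $A$ the set of
    loops meeting $F_1$ and $F_2$; the finite Green's function makes $\mu(A)$ finite. *)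

Section Words.
Variables (G : digraph) (F1 F2 : {fset vert G}).
Local Notation E := (edge G).
Implicit Types (e : E) (y z r : seq E) (p : seq E * seq E) (u v : seq (seq E * seq E)).

Definition consecutive : rel E := fun e e' => tgt e == src e'.

(** Edge-only form of [is_excursion]. Visits to [F1] are read off the targets; the one vertex left
    out is the starting point, which lies in [F2]. *)
Definition excursion_edges y : bool :=
  if y is e :: y' then
    [&& src e \in F2, tgt (last e y') \in F2,
        all (fun e' => src e' \notin F2) y' & has (fun e' => tgt e' \in F1) y]
  else false.

Definition piece p : seq E := p.1 ++ p.2.

(** An empty bridge satisfies the last condition trivially: its endpoint is the end of the excursion
    before it, already known to be in [F2]. *)
Definition piece_ok p : bool :=
  [&& excursion_edges p.1, all (fun e => tgt e \notin F1) p.2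
    & if p.2 is e :: q then tgt (last e q) \in F2 else true].

Definition join u : seq E := flatten [seq piece p | p <- u].

Lemma excursion_edgesP e0 y : reflect
  [/\ 0 < size y, src (nth e0 y 0) \in F2, tgt (nth e0 y (size y).-1) \in F2,
      forall i, 0 < i < size y -> src (nth e0 y i) \notin F2
    & exists2 i, i < size y & tgt (nth e0 y i) \in F1]
  (excursion_edges y).
Proof.
case: y => [|e y] /=; first by apply: (iffP idP) => // -[].
apply: (iffP and4P) => [[-> l /allP a h]|[_ f l a [j jl h]]].
  have /(has_nthP e0) [i il hi] : has (fun e' => tgt e' \in F1) (e :: y) by [].
  split => //; first by rewrite -last_nth.
    by move=> [|k] //= kl; apply/a/mem_nth.
  by exists i.
split => //; first by rewrite -last_nth in l.
  by apply/(all_nthP e0) => i il; apply: (a i.+1).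
have // : has (fun e' => tgt e' \in F1) (e :: y).
by apply/(has_nthP e0); exists j.
Qed.

Lemma excursion_edges_size y : excursion_edges y -> 0 < size y.
Proof. by case: y. Qed.

Lemma sorted_consecutive e0 z i : sorted consecutive z -> 0 < i < size z ->
  src (nth e0 z i) = tgt (nth e0 z i.-1).
Proof.
by case: i => // i /(sortedP e0) s il; apply/esym/eqP/s.
Qed.

(** The shorter prefix ends in [F2], so the next edge leaves from [F2], which is forbidden in the
    interior of the longer one. *)
Lemma excursion_prefix_lt z k k' : sorted consecutive z -> k < k' <= size z ->
  excursion_edges (take k z) -> ~~ excursion_edges (take k' z).
Proof.
case: z => [|e0 z0]; first by rewrite leqn0 => _ /andP[/[swap]/eqP->].
set z := e0 :: z0 => sz /andP[kk' k'z] /(excursion_edgesP e0).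
rewrite size_takel; last by exact: leq_trans (ltnW kk') k'z.
move=> [k0 _ e1 _ _]; apply/negP => /(excursion_edgesP e0); rewrite size_takel //.
move=> [_ _ _ /(_ k)]; rewrite k0 kk' nth_take // => /(_ isT) + _.
rewrite sorted_consecutive //; last by rewrite k0 (leq_trans kk').
by move: e1; rewrite nth_take ?prednK // => ->.
Qed.

Lemma excursion_prefix_uniq z k k' : sorted consecutive z -> k <= size z ->
  k' <= size z -> excursion_edges (take k z) -> excursion_edges (take k' z) ->
  k = k'.
Proof.
move=> sz kz k'z ek ek'; case: (ltngtP k k') => // lt.
- by have := excursion_prefix_lt sz (k := k) (k' := k'); rewrite lt k'z ek ek' => /(_ isT isT).
- by have := excursion_prefix_lt sz (k := k') (k' := k); rewrite lt kz ek ek' => /(_ isT isT).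
Qed.

Lemma excursion_piece p r : excursion_edges p.1 ->
  excursion_edges (take (size p.1) (piece p ++ r)).
Proof. by rewrite /piece -catA take_size_cat. Qed.

(** A start inside the excursion of [p] is not in [F2]. From a start inside the bridge, a path that
    stays in the bridge misses [F1], and a longer one passes through the end of the bridge, which is
    in [F2]. *)
Lemma no_excursion_inside p r t k : piece_ok p -> sorted consecutive (piece p ++ r) ->
  0 < t < size (piece p) -> ~~ excursion_edges (take k (drop t (piece p ++ r))).
Proof.
move=> /and3P[exa nF1 lF2] sz /andP[t0 tp].
set z := piece p ++ r in sz *.
have tz : t < size z by rewrite size_cat ltn_addr.
wlog kz : k / k <= size (drop t z).
  move=> H; have [/H//|] := leqP k (size (drop t z)).
  by move=> /ltnW kz; have := H _ (leqnn _); rewrite !take_oversize.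
have e0 : E by case: (p.1) exa => // e ?; exact: e.
apply/negP => /(excursion_edgesP e0); rewrite size_takel //.
move=> [k0 h0 _ hi [i ik hF1]].
rewrite nth_take // nth_drop addn0 in h0.
rewrite nth_take // nth_drop in hF1.
have [ta|ta] := ltnP t (size p.1).
  case/(excursion_edgesP e0): exa => _ _ _ /(_ t); rewrite t0 ta => /(_ isT) + _.
  by move: h0; rewrite /z /piece -catA nth_cat ta => ->.
have szp : size (piece p) = size p.1 + size p.2 by rewrite size_cat.
have p20 : 0 < size p.2 by move: tp; rewrite szp; lia.
have lastF2 : tgt (nth e0 z (size (piece p)).-1) \in F2.
  rewrite /z nth_cat ifT; last by rewrite szp; lia.
  rewrite /piece nth_cat ifF; last by rewrite -/(piece p) szp; lia.
  move: lF2 p20; rewrite -/(piece p) szp; case: (p.2) => //= e q lF2 _.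
  by rewrite addnS /= addnC addnK -last_nth.
have [ki|ki] := leqP k (size (piece p) - t).
  move: hF1; rewrite /z nth_cat ifT; last by lia.
  rewrite /piece nth_cat ifF; last by lia.
  apply/negP/(allP nF1)/mem_nth.
  rewrite ltn_subLR; last exact: leq_trans ta (leq_addr _ _).
  by rewrite -szp -(subnKC (ltnW tp)) ltn_add2l (leq_trans ik).
have := hi (size (piece p) - t); rewrite ki subn_gt0 tp => /(_ isT).
rewrite nth_take // nth_drop subnKC; last exact: ltnW.
rewrite sorted_consecutive // ?lastF2 //.
by move: kz; rewrite size_drop; lia.
Qed.

Definition starts_excursion z : bool :=
  has (fun k => excursion_edges (take k z)) (iota 0 (size z).+1).

Lemma starts_excursionP z :
  reflect (exists k, excursion_edges (take k z)) (starts_excursion z).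
Proof.
apply: (iffP hasP) => [[k _ ?]|[k ek]]; first by exists k.
have [kz|/ltnW kz] := leqP k (size z); first by exists k; rewrite // mem_iota.
by exists (size z); [rewrite mem_iota /= | rewrite take_size -(take_oversize kz)].
Qed.

Lemma join_cons p u : join (p :: u) = piece p ++ join u. Proof. by []. Qed.
Lemma join_cat u v : join (u ++ v) = join u ++ join v.
Proof. by rewrite /join map_cat flatten_cat. Qed.

(* A shorter first bridge would be followed by an excursion, which cannot start
   inside the longer first piece. *)
Lemma join_inj u v : all piece_ok u -> all piece_ok v ->
  sorted consecutive (join u) -> join u = join v -> u = v.
Proof.
have piece0 p : piece_ok p -> 0 < size (piece p).
  by rewrite size_cat => /and3P[/excursion_edges_size]; case: (size _).
elim: u v => [|p u IH] [|q v] //=.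
- by move=> _ /andP[/piece0 + _] _; rewrite join_cons; case: (piece q).
- by move=> /andP[/piece0 + _]; rewrite join_cons; case: (piece p).
move=> /andP[okp oku] /andP[okq okv] sz e.
have szpq : size (piece p) = size (piece q).
  wlog lt : p q u v {IH} okp oku okq okv sz e / size (piece p) < size (piece q).
    move=> H; case: (ltngtP (size (piece p)) (size (piece q))) => // lt.
      exact: (H _ _ _ _ okp oku okq okv).
    by apply/esym/(H _ _ _ _ okq okv okp oku) => //; rewrite -e.
  have := @no_excursion_inside q (join v) (size (piece p)) _ okq.
  move: e sz; rewrite !join_cons => e; rewrite e lt piece0 // -e => sz H.
  case: u oku e sz H => [_ e _ _|p' u /andP[okp' _] e sz H].
    by move: (congr1 size e) lt; rewrite /= cats0 size_cat; lia.
  have /negP[] := H (size p'.1) sz isT.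
  by rewrite drop_size_cat // join_cons excursion_piece //; case/and3P: okp'.
move: (e); rewrite !join_cons => /eqP; rewrite eqseq_cat // => /andP[/eqP epq /eqP euv].
have -> : p = q.
  (* Equal pieces are cut at the same place, since a chained word has at most one excursion as a
     prefix. *)
  suff eq1 : size p.1 = size q.1.
    move: epq; rewrite /piece => /eqP; rewrite eqseq_cat // => /andP[/eqP + /eqP].
    by case: (p) (q) => ? ? [? ?] /= -> ->.
  have [s1 s2] : size p.1 <= size (join (p :: u)) /\ size q.1 <= size (join (p :: u)).
    by rewrite e -{1}e !join_cons /piece !size_cat -!addnA !leq_addr.
  apply: (excursion_prefix_uniq sz) => //.
    by rewrite join_cons excursion_piece //; case/and3P: okp.
  by rewrite e join_cons excursion_piece //; case/and3P: okq.
rewrite (IH v) //; move: sz; rewrite join_cons.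
by move=> /cat_sorted2[].
Qed.

(** Only the rotations that begin at a piece begin with an excursion. The list-valued [Q] is left
    free to serve twice: for listing the excursions of a loop and for counting the rotations equal
    to a given word. *)
Lemma flatten_rot_join (X : Type) (Q : seq E -> seq X) u :
  all piece_ok u -> cycle consecutive (join u) ->
  (forall z, ~~ starts_excursion z -> Q z = [::]) ->
  flatten [seq Q (rot t (join u)) | t <- iota 0 (size (join u))] =
  flatten [seq Q (join (rot i u)) | i <- iota 0 (size u)].
Proof.
move=> oku cu Q0.
(* Generalized to the rotations that start in the last pieces [w], for an induction on [w] while [u]
   stays fixed. *)
suff H v w : u = v ++ w ->
  flatten [seq Q (rot t (join u)) | t <- iota (size (join v)) (size (join w))] =
  flatten [seq Q (join (rot i u)) | i <- iota (size v) (size w)] by exact: (H [::]).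
elim: w v => [|p w IH] v uE //=.
have okp : piece_ok p by move: oku; rewrite uE all_cat /= => /and3P[].
rewrite join_cons size_cat iotaD map_cat flatten_cat.
have -> : size (join v) + size (piece p) = size (join (rcons v p)).
  by rewrite -cats1 join_cat size_cat /= join_cons cats0.
rewrite IH; last by rewrite uE cat_rcons.
rewrite size_rcons; congr (_ ++ _).
have drop_piece t r : t <= size (piece p) ->
    drop t (piece p ++ r) = drop t (piece p) ++ r.
  rewrite drop_cat; case: ltnP => // pt tp.
  have -> : t = size (piece p) by apply/eqP; rewrite eqn_leq tp.
  by rewrite subnn drop_size drop0.
have rE t : t <= size (piece p) ->
    rot (size (join v) + t) (join u) = drop t (piece p ++ (join w ++ join v)) ++ take t (piece p).
  move=> tp; rewrite uE join_cat join_cons /rot drop_cat take_cat.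
  rewrite ltnNge leq_addr /= addKn takel_cat // !drop_piece //.
  by rewrite -!catA.
have eqrot : rot (size (join v)) (join u) = join (rot (size v) u).
  by rewrite uE rot_size_cat !join_cat rot_size_cat.
have : size (piece p) > 0 by rewrite size_cat; case/and3P: okp => /excursion_edges_size; case: (size _).
case sp : (size (piece p)) => [//|n] _ /=; rewrite eqrot.
rewrite -[RHS]cats0; congr (_ ++ _).
suff : forall t, 0 < t < size (piece p) -> Q (rot (size (join v) + t) (join u)) = [::].
  move=> H; rewrite -addn1 iotaDl -map_comp.
  rewrite (eq_in_map _ (fun=> [::]) _).1; first by elim: (iota _ _).
  by move=> t; rewrite mem_iota => /andP[t1 tn]; apply: H; rewrite sp t1; lia.
move=> t tp; apply: Q0; apply/negP => /starts_excursionP [k].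
rewrite rE; last by case/andP: tp => _ /ltnW.
have rr : drop t (piece p ++ (join w ++ join v)) ++ take t (piece p)
   = drop t (piece p ++ (join w ++ join v ++ take t (piece p))).
  by case/andP: tp => _ /ltnW tp; rewrite !drop_piece // -!catA.
rewrite {}rr; apply/negP/no_excursion_inside => //.
(* The word in question runs once around the cycle from the start of [p] and then repeats the first
   [t] edges; a cyclic chain continued past a full turn is still a chain. *)
have : cycle consecutive (rot (size (join v) + 0) (join u)) by rewrite rot_cycle.
rewrite rE // drop0 take0 cats0 => cz.
case: (piece p) cz sp tp => [|e z] //= + _ _.
rewrite rcons_cat cat_path => /andP[c1 c2].
move: c2; rewrite -cats1 !cat_path c1 /= => /andP[/andP[-> ->] /andP[a _]] /=.
case: t => //= t.
have := c1; rewrite -[z in X in X -> _](cat_take_drop t) cat_path => /andP[-> _].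
by rewrite andbT; move: a; rewrite !last_cat.
Qed.

End Words.

(** * Isomorphisms of coloured permutations *)

Lemma map_nth_index (X : eqType) (xs ys : seq X) : uniq xs ->
  size ys = size xs -> [seq nth r ys (index r xs) | r <- xs] = ys.
Proof.
case: xs => [|z xs]; first by case: ys.
move=> uxs sz; apply: (@eq_from_nth _ z) => [|i]; rewrite size_map // => il.
rewrite (nth_map z) // index_uniq //; apply: set_nth_default.
by rewrite sz.
Qed.

Section ColouredPermutations.
Variable I : finType.

Lemma iter_mod_order (f : I -> I) (injf : injective f) x k :
  iter (k %% order f x) f x = iter k f x.
Proof.
rewrite [in RHS](divn_eq k (order f x)) addnC iterD; congr iter.
by elim: (k %/ _) => // q IH; rewrite mulSn iterD -IH (iter_order injf).
Qed.

Lemma eq_iter_order (f : I -> I) (injf : injective f) x k k' :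
  (iter k f x == iter k' f x) = (k == k' %[mod order f x]).
Proof.
apply/eqP/eqP => [|e]; last by rewrite -iter_mod_order // e iter_mod_order.
rewrite -iter_mod_order // -(iter_mod_order injf x k') => e.
have lt m : m %% order f x < order f x by rewrite ltn_mod order_gt0.
by rewrite -(findex_iter (lt k)) e findex_iter.
Qed.

(** The product of $J(L)^{m(L)}\,m(L)!$ over the distinct entries $L$ (see [symmetry_factorE]), in a
    recursive form that follows the one-by-one choice of images in [card_extensions]. *)
Fixpoint symmetry_factor (C : eqType) (J : C -> nat) (ls : seq C) : nat :=
  if ls is L :: ls' then
    (J L * (count_mem L ls').+1 * symmetry_factor J ls')%N
  else 1%N.

Definition root_seq (s : {perm I}) : seq I := enum (froots s).

Lemma mem_root_seq (s : {perm I}) x : (x \in root_seq s) = (froot s x == x).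
Proof. by rewrite mem_enum. Qed.

Lemma perm_connect_sym (s : {perm I}) : connect_sym (frel s).
Proof. exact/fconnect_sym/perm_inj. Qed.

Lemma froot_froot (s : {perm I}) x : froot s (froot s x) = froot s x.
Proof. exact/fingraph.root_root/perm_connect_sym. Qed.

Lemma froot_perm (s : {perm I}) x : froot s (s x) = froot s x.
Proof.
by apply/(fingraph.rootP (perm_connect_sym s)); rewrite perm_connect_sym fconnect1.
Qed.

Lemma froot_iter (s : {perm I}) k x : froot s (iter k s x) = froot s x.
Proof. by elim: k => //= k <-; rewrite froot_perm. Qed.

Lemma eq_froot_iter (s : {perm I}) x y : froot s x = froot s y ->
  exists k, x = iter k s y.
Proof.
move=> /(fingraph.rootP (perm_connect_sym s)); rewrite perm_connect_sym.
by move=> /iter_findex <-; eexists.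
Qed.

Lemma mem_orbit_root (s : {perm I}) x y : (y \in orbit s x) = (froot s y == froot s x).
Proof.
rewrite -fconnect_orbit perm_connect_sym.
by apply/idP/eqP => /(fingraph.rootP (perm_connect_sym s)).
Qed.

Lemma perm_flatten_orbits (s : {perm I}) (R : seq I) :
  uniq R -> {subset R <= root_seq s} ->
  perm_eq (flatten [seq orbit s r | r <- R]) [seq y <- enum I | froot s y \in R].
Proof.
have memR Q y : {subset Q <= root_seq s} ->
    (y \in flatten [seq orbit s r | r <- Q]) = (froot s y \in Q).
  move=> sQ; apply/flatten_mapP/idP => [[r rQ]|yQ].
    by rewrite mem_orbit_root; move/sQ: (rQ); rewrite mem_root_seq => /eqP -> /eqP ->.
  by exists (froot s y); rewrite // mem_orbit_root froot_froot.
move=> uR sR; apply: uniq_perm; last by move=> y; rewrite memR // mem_filter mem_enum andbT.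
  elim: R uR sR => //= r R IH /andP[rR uR] sR.
  have sR' : {subset R <= root_seq s} by move=> y yR; apply: sR; rewrite inE yR orbT.
  rewrite cat_uniq orbit_uniq IH // andbT; apply/hasPn => y; rewrite memR // => yR.
  rewrite mem_orbit_root; apply: contraNN rR => /eqP yr.
  by have := sR r (mem_head _ _); rewrite mem_root_seq -yr => /eqP <-.
by rewrite filter_uniq // enum_uniq.
Qed.

Lemma perm_flatten_root_seq (s : {perm I}) :
  perm_eq (flatten [seq orbit s r | r <- root_seq s]) (enum I).
Proof.
rewrite (permPl (perm_flatten_orbits _ _)) ?enum_uniq //.
by rewrite (eq_filter (a2 := predT)) ?filter_predT // => y; rewrite mem_root_seq froot_froot eqxx.
Qed.

(** A conjugation maps cycles to cycles but not chosen representatives to chosen representatives,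
    hence the [froot s] after [f]. *)
Lemma perm_root_seq_conj (f : {perm I}) (s0 s : {perm I}) :
  (forall x, f (s0 x) = s (f x)) ->
  perm_eq [seq froot s (f r) | r <- root_seq s0] (root_seq s).
Proof.
move=> fs.
have fiter k x : f (iter k s0 x) = iter k s (f x) by elim: k => //= k <-.
have ffroot x : froot s (f (froot s0 x)) = froot s (f x).
  have [k {2}->] : exists k, x = iter k s0 (froot s0 x).
    by apply: eq_froot_iter; rewrite froot_froot.
  by rewrite fiter froot_iter.
apply: uniq_perm; rewrite ?enum_uniq //.
  apply/dinjectiveP => x y /eqP xx /eqP yy /eq_froot_iter[k].
  rewrite -fiter => /perm_inj; move: xx => + xy; rewrite xy froot_iter.
  by rewrite yy.
move=> r; rewrite mem_root_seq; apply/mapP/eqP => [[x _ ->]|rr].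
  by rewrite froot_froot.
exists (froot s0 (f^-1%g r)); first by rewrite mem_root_seq froot_froot.
by rewrite ffroot permKV rr.
Qed.

Lemma symmetry_factorE (C : eqType) (J : C -> nat) (ls : seq C) :
  symmetry_factor J ls =
  (\prod_(L <- undup ls) (J L ^ count_mem L ls * (count_mem L ls)`!))%N.
Proof.
elim: ls => [|L ls IH] /=; first by rewrite big_nil.
have stepE q : L \notin q -> (\prod_(K <- q) (J K ^ ((L == K) + count_mem K ls) *
    ((L == K) + count_mem K ls)`!) =
    \prod_(K <- q) (J K ^ count_mem K ls * (count_mem K ls)`!))%N.
  move=> Lq; apply: eq_big_seq => K Kq.
  by case: eqP => // LK; rewrite LK Kq in Lq.
case: ifP => [Lls|Lls]; last first.
  rewrite big_cons eqxx stepE ?mem_undup ?Lls // -IH.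
  have -> : count_mem L ls = 0 by apply/count_memPn; rewrite Lls.
  by rewrite addn0 expn1 !muln1.
have Lu : L \in undup ls by rewrite mem_undup.
rewrite (bigD1_seq L) ?undup_uniq //= eqxx.
rewrite -[in RHS]big_filter stepE ?mem_filter ?eqxx // big_filter.
rewrite IH (bigD1_seq L) ?undup_uniq //=.
by rewrite add1n factS expnS [LHS]mulnA (mulnACA (J L)).
Qed.

(** The model for a colour is the whole loop read from an index on: equal colours at two points then
    force equal cycle lengths and equal colours one step later. The map [cls] forgets the base
    point, and [J] is the number of base points in a cycle that give the same rooted loop. *)
Variables (s0 s : {perm I}) (Wt C : eqType) (W0 W : I -> Wt) (cls : Wt -> C).
Variable (J : C -> nat).
Hypothesis W_order : forall x y, W y = W0 x -> order s y = order s0 x.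
Hypothesis W_step : forall x y, W y = W0 x -> W (s y) = W0 (s0 x).
Hypothesis cls_step : forall y, cls (W (s y)) = cls (W y).
Hypothesis count_W : forall x y, cls (W y) = cls (W0 x) ->
  count (fun z => W z == W0 x) (orbit s y) = J (cls (W0 x)).

Definition isomorphisms : {set {perm I}} :=
  [set f : {perm I} | [forall x, (f (s0 x) == s (f x)) && (W (f x) == W0 x)]].

Lemma isomorphismsP (f : {perm I}) : reflect
  ((forall x, f (s0 x) = s (f x)) /\ forall x, W (f x) = W0 x)
  (f \in isomorphisms).
Proof.
rewrite inE; apply: (iffP forallP) => [H|[H1 H2] x]; last by rewrite H1 H2 !eqxx.
by split => x; have /andP[/eqP ? /eqP ?] := H x.
Qed.

Lemma iso_iter (f : {perm I}) x k : f \in isomorphisms ->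
  f (iter k s0 x) = iter k s (f x).
Proof. by move=> /isomorphismsP[H _]; elim: k => //= k <-. Qed.

Lemma W_iter x y k : W y = W0 x -> W (iter k s y) = W0 (iter k s0 x).
Proof. by move=> e; elim: k => //= k; exact: W_step. Qed.

Lemma cls_iter y k : cls (W (iter k s y)) = cls (W y).
Proof. by elim: k => //= k <-; exact: cls_step. Qed.

Lemma cls_froot y : cls (W (froot s y)) = cls (W y).
Proof.
have [k {1}->] : exists k, froot s y = iter k s y.
  by apply: eq_froot_iter; rewrite froot_froot.
exact: cls_iter.
Qed.

Section Extension.
Variable psi : I -> I.
Hypothesis W_psi : forall r, froot s0 r = r -> W (psi r) = W0 r.
Hypothesis psi_inj : forall r r', froot s0 r = r -> froot s0 r' = r' ->
  froot s (psi r) = froot s (psi r') -> r = r'.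

(** The only candidate: walk from the root to [z] along [s0] and repeat as many steps along [s] from
    the image of the root. Equality of the cycle lengths makes this compatible with going around. *)
Let ext z := iter (findex s0 (froot s0 z) z) s (psi (froot s0 z)).

Let ext_iter r k : froot s0 r = r -> ext (iter k s0 r) = iter k s (psi r).
Proof.
move=> rr; rewrite /ext froot_iter rr; apply/eqP.
rewrite (eq_iter_order (@perm_inj _ s)) (W_order (W_psi rr)).
rewrite -(eq_iter_order (@perm_inj _ s0)) iter_findex //.
exact: fconnect_iter.
Qed.

Let iterE z : exists2 k, z = iter k s0 (froot s0 z) & froot s0 (froot s0 z) = froot s0 z.
Proof.
have rr := froot_froot s0 z.
by have /eq_froot_iter[k e] := esym rr; exists k.
Qed.

Let ext_inj : injective ext.
Proof.
move=> z z'; have [k + rr] := iterE z; have [k' + rr'] := iterE z'.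
move: (froot s0 z) (froot s0 z') rr rr' => r r' rr rr' -> ->.
rewrite !ext_iter // => e.
have rE : r = r' by apply: psi_inj => //; have := congr1 (froot s) e; rewrite !froot_iter.
subst r'; apply/eqP; rewrite (eq_iter_order (@perm_inj _ s0)).
by rewrite -(W_order (W_psi rr)) -(eq_iter_order (@perm_inj _ s)) e.
Qed.

Lemma card_extension (xs : seq I) : xs =i root_seq s0 ->
  #|[set f : {perm I} | (f \in isomorphisms) && (map f xs == map psi xs)]| = 1%N.
Proof.
move=> xsE; rewrite (_ : [set _ | _] = [set perm ext_inj]) ?cards1 //.
apply/setP => f; rewrite finset.in_set1 finset.in_set; apply/andP/eqP => [[fiso /eqP fxs]|->].
  apply/permP => z; rewrite permE; have [k + rr] := iterE z.
  move: (froot s0 z) rr => r rr ->; rewrite iso_iter // ext_iter //; congr (iter k s _).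
  by move/eq_in_map: fxs; apply; rewrite xsE mem_root_seq rr.
split.
  apply/isomorphismsP; split => z; rewrite !permE; have [k + rr] := iterE z;
    move: (froot s0 z) rr => r rr ->.
    by rewrite -iterS !ext_iter.
  by rewrite ext_iter // (W_iter _ (W_psi rr)).
apply/eqP/eq_in_map => r; rewrite xsE mem_root_seq => /eqP rr.
by rewrite permE; exact: (ext_iter 0 rr).
Qed.
End Extension.

(** The class is constant along cycles, so a cycle of another class contributes nothing and one of
    the class of [x] contributes [J]. The subtraction is not truncated, as [R] is a duplicate-free
    part of the roots. *)
Lemma count_avoiding (R : seq I) x : uniq R -> {subset R <= root_seq s} ->
  #|[set y | (W y == W0 x) && (froot s y \notin R)]| =
  (J (cls (W0 x)) * (count_mem (cls (W0 x)) (map (cls \o W) (root_seq s))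
                    - count_mem (cls (W0 x)) (map (cls \o W) R)))%N.
Proof.
move=> uR sR; set L := cls (W0 x).
have rootsE : perm_eq (root_seq s) (R ++ [seq r <- root_seq s | r \notin R]).
  apply: uniq_perm; first exact: enum_uniq.
    rewrite cat_uniq uR filter_uniq ?enum_uniq // andbT; apply/hasPn => r.
    by rewrite mem_filter => /andP[].
  move=> r; rewrite mem_cat mem_filter; case: (boolP (r \in R)) => //= /sR.
  by [].
set Q := [seq r <- _ | _] in rootsE.
have -> : (count_mem L (map (cls \o W) (root_seq s)) - count_mem L (map (cls \o W) R)
    = count_mem L (map (cls \o W) Q))%N.
  by rewrite (seq.permP (perm_map _ rootsE)) map_cat count_cat addKn.
have sQ : {subset Q <= root_seq s} by move=> y; rewrite mem_filter => /andP[].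
have uQ : uniq Q by rewrite filter_uniq ?enum_uniq.
have -> : #|[set y | (W y == W0 x) && (froot s y \notin R)]| =
    count (fun y => W y == W0 x) (flatten [seq orbit s r | r <- Q]).
  rewrite (seq.permP (perm_flatten_orbits uQ sQ)) cardE -size_filter.
  rewrite -filter_predI /enum_mem -filter_predI; congr size; apply: eq_filter => y.
  by rewrite /= !inE mem_filter mem_root_seq froot_froot eqxx !andbT.
elim: Q {rootsE sQ uQ} => [|r Q IH]; first by rewrite muln0.
rewrite /= count_cat IH mulnDr; congr (_ + _)%N.
case: eqP => [e|ne]; first by rewrite muln1 count_W.
rewrite muln0; apply/eqP; rewrite -leqn0 leqNgt -has_count; apply/hasPn => y.
move=> /trajectP[k _ ->]; apply/eqP => e; apply: ne.
by rewrite /= -(cls_iter r k) e.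
Qed.

(* The images of the roots of [s0] are chosen one after another: when the turn of
   a root of class [L] comes, every cycle of [s] of class [L] not yet used offers
   [J L] possible images. *)
Lemma card_extensions xs rest ys : root_seq s0 = xs ++ rest ->
  map W ys = map W0 xs -> uniq (map (froot s) ys) ->
  perm_eq (map (cls \o W0) (root_seq s0)) (map (cls \o W) (root_seq s)) ->
  #|[set f : {perm I} | (f \in isomorphisms) && (map f xs == ys)]| =
  symmetry_factor J (map (cls \o W0) rest).
Proof.
move=> + + + permc.
elim: rest xs ys => [|x rest IH] xs ys E WE uys.
  rewrite cats0 in E.
  have sz : size ys = size xs by have := congr1 size WE; rewrite !size_map.
  have uxs : uniq xs by rewrite -E enum_uniq.
  pose psi r := nth r ys (index r xs).
  have psiE : ys = map psi xs by rewrite map_nth_index.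
  rewrite psiE; apply: card_extension => [r rr|r r' rr rr' e|r]; last by rewrite E.
  - have rxs : r \in xs by rewrite -E mem_root_seq rr.
    by move: WE; rewrite psiE -map_comp => /eq_in_map /(_ _ rxs).
  - move: uys; rewrite psiE -map_comp -E => /dinjectiveP; apply => //.
      by apply/eqP.
    by apply/eqP.
have uE : uniq (xs ++ x :: rest) by rewrite -E enum_uniq.
have rootE z : z \in xs ++ x :: rest -> froot s0 z = z.
  by rewrite -E mem_root_seq => /eqP.
set R := map (froot s) ys; set L := cls (W0 x).
have -> : symmetry_factor J (map (cls \o W0) (x :: rest)) =
    \sum_(y | (W y == W0 x) && (froot s y \notin R))
      symmetry_factor J (map (cls \o W0) rest).
  rewrite sum_nat_const /= -/L; congr (_ * _)%N.
  rewrite (_ : #|_| = #|[set y | (W y == W0 x) && (froot s y \notin R)]|); last first.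
    by apply: eq_card => y; rewrite !inE.
  rewrite count_avoiding //; last first.
    by move=> _ /mapP[y _ ->]; rewrite mem_root_seq froot_froot.
  rewrite -/L; congr (_ * _)%N.
  rewrite -(seq.permP permc) E map_cat count_cat /= eqxx add1n.
  (* The cycles already used have the classes of the roots already treated, so what remains of the
     class [L] is [x] itself and its occurrences in [rest]. *)
  suff -> : map (cls \o W) R = map (cls \o W0) xs by rewrite addKn.
  by rewrite (map_comp cls W0) -WE -!map_comp; apply: eq_map => y /=; exact: cls_froot.
rewrite -sum1_card (partition_big (fun f : {perm I} => f x) predT) //= [RHS]big_mkcond /=.
apply: eq_bigr => y _.
have -> : (\sum_(i | (i \in [set f : {perm I} | (f \in isomorphisms) && (map f xs == ys)])
             && (i x == y)) 1 =
   #|[set f : {perm I} | (f \in isomorphisms) && (map f (rcons xs x) == rcons ys y)]|)%N.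
  rewrite -sum1_card; apply: eq_bigl => f; rewrite !finset.in_set -andbA; congr (_ && _).
  by rewrite map_rcons eqseq_rcons.
case: ifP => [/andP[/eqP Wy yR]|/negP ny].
  apply: IH; first by rewrite cat_rcons.
    by rewrite !map_rcons WE Wy.
  by rewrite map_rcons rcons_uniq yR uys.
apply/eqP; rewrite cards_eq0; apply/eqP/setP => f; rewrite !finset.in_set.
apply/negP => /andP[fiso]; rewrite map_rcons eqseq_rcons => /andP[/eqP fxs /eqP fx].
have {}fiso : f \in isomorphisms by rewrite finset.in_set.
have /isomorphismsP[_ Wf] := fiso.
apply: ny; rewrite -fx Wf eqxx /=.
(* If [f x] lay in a used cycle, [x] would lie in the cycle of an earlier root [z], but distinct
   roots have distinct cycles. *)
apply/negP; rewrite /R -fxs -map_comp => /mapP[z zxs /= /eq_froot_iter[k]].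
rewrite -iso_iter // => /perm_inj xz.
move: uE; rewrite cat_uniq => /and3P[_ /hasPn/(_ x)]; rewrite mem_head => /(_ isT).
suff -> : x = z by rewrite /= zxs.
rewrite -(rootE x) ?mem_cat ?mem_head ?orbT // xz froot_iter rootE //.
by rewrite mem_cat zxs.
Qed.

Lemma card_isomorphisms :
  perm_eq (map (cls \o W0) (root_seq s0)) (map (cls \o W) (root_seq s)) ->
  #|isomorphisms| = symmetry_factor J (map (cls \o W0) (root_seq s0)).
Proof.
move=> /(card_extensions (xs := [::]) (ys := [::]) erefl erefl isT) <-.
by apply: eq_card => f; rewrite !finset.in_set andbT.
Qed.

End ColouredPermutations.

(** * Rotations of loops *)

Lemma size_undup_const (X : eqType) (s : seq X) n :
  (forall x, x \in s -> count_mem x s = n) -> size s = (size (undup s) * n)%N.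
Proof.
move=> H; rewrite -(perm_size (perm_count_undup s)) size_flatten /shape -map_comp.
rewrite (eq_in_map _ (fun=> n) _).1; last first.
  by move=> x; rewrite mem_undup /= size_nseq => /H.
by elim: (undup s) => //= _ q ->; rewrite mulSn.
Qed.

Section Rotations.
Variable X : eqType.
Implicit Types a b : seq X.

Definition rotations a : seq (seq X) := [seq rot t a | t <- iota 0 (size a)].

Lemma size_rotations a : size (rotations a) = size a.
Proof. by rewrite size_map size_iota. Qed.

Lemma map_rot_rotations i a : map (rot i) (rotations a) = rotations (rot i a).
Proof.
by rewrite /rotations size_rot -map_comp; apply: eq_map => t /=; rewrite rot_rot.
Qed.

Lemma perm_rotations i a : perm_eq (rotations (rot i a)) (rotations a).
Proof.
suff H b : perm_eq (rotations (rot 1 b)) (rotations b).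
  elim: i => [|i IH]; first by rewrite rot0.
  have [il|il] := ltnP i (size a); first by rewrite rotS // (permPl (H _)).
  by move: IH; rewrite rot_oversize // rot_oversize // leqW.
rewrite /rotations size_rot; case sb : (size b) => [//|n].
have -> : [seq rot t (rot 1 b) | t <- iota 0 n.+1] = [seq rot t b | t <- iota 1 n.+1].
  rewrite (iotaDl 1 0) -map_comp; apply/eq_in_map => t; rewrite mem_iota => tn.
  by rewrite /= rot_rot -rotS // sb.
rewrite -{1}[n.+1]addn1 iotaD map_cat /= perm_catC /=.
by rewrite add1n -sb rot_size rot0.
Qed.
End Rotations.

Section Loops.
Variable G : digraph.
Local Notation E := (edge G).
Implicit Types (l : rooted_loop G) (L : loop G).

Lemma is_walk_cat (x : vert G) (y z : seq E) :
  is_walk (Walk x (y ++ z)) =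
  is_walk (Walk x y) && is_walk (Walk (finish (Walk x y)) z).
Proof.
rewrite /is_walk /finish /= !map_cat belast_cat eqseq_cat ?size_belast ?size_map //.
Qed.

Lemma finish_cat (x : vert G) (y z : seq E) :
  finish (Walk x (y ++ z)) = finish (Walk (finish (Walk x y)) z).
Proof. by rewrite /finish /= map_cat last_cat. Qed.

Lemma finish_cons (x : vert G) e (z : seq E) :
  finish (Walk x (e :: z)) = tgt (last e z).
Proof. by rewrite /finish /= last_map. Qed.

Lemma is_walk_cons (x : vert G) e (z : seq E) :
  is_walk (Walk x (e :: z)) = (src e == x) && path (@consecutive G) e z.
Proof.
rewrite /is_walk /= eqseq_cons; congr (_ && _).
elim: z e => //= e' z IH e; rewrite eqseq_cons IH /consecutive; congr (_ && _).
exact: eq_sym.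
Qed.

Lemma is_loop_cons (x : vert G) e (z : seq E) :
  is_loop (Walk x (e :: z)) = (src e == x) && cycle (@consecutive G) (e :: z).
Proof.
rewrite /is_loop is_walk_cons finish_cons /= rcons_path -andbA; case: eqP => //= <-.
by rewrite /consecutive.
Qed.

Lemma loop_size l : (0 < size (wedges l)).
Proof. by case/and3P: (loop_walkP l). Qed.

Lemma loop_cycle l : cycle (@consecutive G) (wedges l).
Proof.
case: l => -[x [|e z]] //= il; have := il; rewrite is_loop_cons.
by case/andP.
Qed.

Lemma loop_start e0 l : start l = src (nth e0 (wedges l) 0).
Proof.
case: l => -[x [|e z]] /= il; first by case/and3P: il.
by have := il; rewrite is_loop_cons /= => /andP[/eqP].
Qed.

Lemma loop_wedges_inj l l' : wedges l = wedges l' -> l = l'.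
Proof.
move=> e; apply: val_inj => /=.
have [e0 _] : exists e0 : E, true by case: (wedges l) (loop_size l) => // e0; exists e0.
have := loop_start e0 l; rewrite e -loop_start.
by case: (loop_walk l) (loop_walk l') e => ? ? [? ?] /= -> ->.
Qed.

Lemma loop_classP l l' :
  loop_class l = loop_class l' <-> exists i, wedges l' = rot i (wedges l).
Proof.
split => [/eqP|H]; first by rewrite eqmodE => /rerootingP.
by apply/eqP; rewrite eqmodE; apply/rerootingP.
Qed.

Lemma loop_repK L : loop_class (loop_rep L) = L.
Proof. exact: reprK. Qed.

(** This is $J(L)$: the rotations that fix a word are the shifts by multiples of its smallest
    period, one for each copy of the repeated block. *)
Definition loop_mult L : nat :=
  count_mem (wedges (loop_rep L)) (rotations (wedges (loop_rep L))).

(** Rotating all entries merely permutes the list of rotations, so all words of a class occur in it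
    equally often. *)
Lemma count_rotations l l' : loop_class l' = loop_class l ->
  count_mem (wedges l') (rotations (wedges l)) = loop_mult (loop_class l).
Proof.
move=> e; have [i ei] : exists i, wedges l' = rot i (wedges (loop_rep (loop_class l))).
  by apply/loop_classP; rewrite loop_repK.
have [j ej] : exists j, wedges l = rot j (wedges (loop_rep (loop_class l))).
  by apply/loop_classP; rewrite loop_repK.
rewrite ei ej (seq.permP (perm_rotations _ _)) /loop_mult.
rewrite -(seq.permP (perm_rotations i _)) -map_rot_rotations count_map.
by apply: eq_count => a /=; rewrite (inj_eq (@rot_inj _ _)).
Qed.

Lemma loop_mult_gt0 L : 0 < loop_mult L.
Proof.
rewrite -has_count; apply/hasP; exists (wedges (loop_rep L)) => //=.
by apply/mapP; exists 0; rewrite ?rot0 // mem_iota /= loop_size.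
Qed.

(** Orbit counting for cyclic shifts. It converts the mass $p(l)/n$ of each rooted loop into the
    mass $p(l)/J(l)$ of the class. *)
Lemma card_loop_class L :
  (size (undup (rotations (wedges (loop_rep L)))) * loop_mult L =
   size (wedges (loop_rep L)))%N.
Proof.
set a := wedges _; rewrite -[RHS]size_rotations.
apply/esym/size_undup_const => b /mapP[i _ ->] /=; rewrite /loop_mult -/a.
rewrite -[in LHS](seq.permP (perm_rotations i a)) -[in LHS]map_rot_rotations count_map.
by apply: eq_count => c /=; rewrite (inj_eq (@rot_inj _ _)).
Qed.

End Loops.

(** * Concatenation of excursions and bridges *)

Lemma orbit_perm (I : finType) (s : {perm I}) x :
  orbit s (s x) = rot 1 (orbit s x).
Proof.
have o : order s (s x) = order s x.
  apply: eq_card => y; rewrite !inE; apply/esym.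
  by apply: (same_connect1 (perm_connect_sym s)); rewrite /= eqxx.
rewrite /orbit o -orderSpred [in LHS]trajectSr trajectS rot1_cons; congr rcons.
by rewrite -iterSr orderSpred (iter_order (@perm_inj _ s)).
Qed.

Lemma orbit_iter (I : finType) (s : {perm I}) x i : i <= order s x ->
  orbit s (iter i s x) = rot i (orbit s x).
Proof.
elim: i => [|i IH] il; first by rewrite rot0.
by rewrite /= orbit_perm IH ?(ltnW il) // -rotS // size_orbit.
Qed.

Lemma rot_join (G : digraph) i (u : seq (seq (edge G) * seq (edge G))) :
  exists k, join (rot i u) = rot k (join u).
Proof.
exists (size (join (take i u))).
by rewrite -{3}(cat_take_drop i u) !join_cat rot_size_cat.
Qed.

Section Concatenation.
Variables (G : digraph) (F1 F2 : {fset vert G}) (D : subgraph G).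
Hypothesis F12 : [disjoint F1 & F2]%fset.
Local Notation E := (edge G).
Local Notation D1 := (remove_vertices D F1).

(** [meets] also tests the starting vertex, which is in [F2] and hence not in [F1]: this is where
    the disjointness enters. *)
Lemma is_excursionE (a : walk G) : is_walk a ->
  is_excursion F1 F2 a = excursion_edges F1 F2 (wedges a).
Proof.
case: a => x [|e y] //; rewrite is_walk_cons => /andP[/eqP ex _].
rewrite /is_excursion finish_cons /= -ex /steps /=.
case x2 : (src e \in F2) => //=; congr [&& _, _ & _].
rewrite /Defs.meets /verts /=.
have -> : (src e \in F1) = false.
  by apply/negbTE; apply: contraL x2; exact: (fdisjointP F12).
by rewrite has_map.
Qed.

Variable h : seq (walk G).
Local Notation N := (size h).
Local Notation exc := (tnth (in_tuple h)).
Implicit Types (b : ubridge G N) (j k : 'I_N).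

Hypothesis walk_h : forall a, a \in h -> is_walk a.
Hypothesis exc_h : forall a, a \in h -> is_excursion F1 F2 a.

Definition pieces b j : seq E * seq E := (wedges (exc j), wedges (b.2 j)).

Definition bridges_of b := ubridges D1 (@exc_finish G h) (@exc_start G h) b.

Lemma wedges_loop_through b j :
  wedges (loop_through b j) = join [seq pieces b k | k <- orbit b.1 j].
Proof. by rewrite /join -map_comp. Qed.

Lemma exc_edges j : excursion_edges F1 F2 (wedges (exc j)).
Proof. by rewrite -is_excursionE ?exc_h ?walk_h ?mem_tnth. Qed.

Section Bridge.
Variable b : ubridge G N.
Hypothesis okb : bridges_of b.

Lemma piece_ok_pieces j : piece_ok F1 F2 (pieces b j).
Proof.
rewrite /piece_ok exc_edges /=.
have [wb sb fb [vb _]] := okb j.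
have nF1 x : x \in verts (b.2 j) -> x \notin F1 by move=> /vb [].
apply/andP; split.
  apply/allP => e eb; apply: nF1; rewrite inE; apply/orP; right.
  by apply/mapP; exists e.
have := exc_edges (b.1 j); rewrite -is_excursionE; last by rewrite walk_h ?mem_tnth.
case/and5P => _ + _ _ _; rewrite -[start _]/(exc_start (b.1 j)) -fb.
by case: (b.2 j) => x [|e y] //=; rewrite finish_cons.
Qed.

(** The number of pieces is arbitrary for the sake of induction; at [n] equal to the order of [j]
    the walk closes up. *)
Lemma is_walk_traject j n (w := Walk (exc_start j)
    (join [seq pieces b k | k <- traject b.1 j n])) :
  is_walk w /\ finish w = exc_start (iter n b.1 j).
Proof.
rewrite {}/w; elim: n j => [|n IH] j //=.
have [wb sb fb _] := okb j; have [IH1 IH2] := IH (b.1 j).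
have wj : is_walk (Walk (exc_start j) (wedges (exc j))).
  have := walk_h (mem_tnth j (in_tuple h)); rewrite /exc_start.
  by case: (tnth _ j).
have fj : finish (Walk (exc_start j) (wedges (exc j))) = start (b.2 j).
  by rewrite sb /exc_finish /exc_start; case: (tnth _ j).
have eb : Walk (start (b.2 j)) (wedges (b.2 j)) = b.2 j by case: (b.2 j).
rewrite join_cons /piece -catA is_walk_cat wj fj is_walk_cat eb wb fb IH1.
by rewrite finish_cat fj finish_cat eb fb IH2 -iterSr.
Qed.

Lemma loop_throughP j : is_loop (loop_through b j).
Proof.
have [w f] := is_walk_traject j (order b.1 j).
rewrite /is_loop /steps.
have -> : loop_through b j = Walk (exc_start j)
    (join [seq pieces b k | k <- orbit b.1 j]).
  by rewrite -wedges_loop_through.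
rewrite w f (iter_order (@perm_inj _ _)) eqxx andbT /=.
rewrite /orbit -orderSpred /= join_cons /piece !size_cat.
by have := excursion_edges_size (exc_edges j); case: (size _).
Qed.

Definition through j : rooted_loop G := RootedLoop (loop_throughP j).

Lemma through_iter j i : i <= order b.1 j ->
  wedges (loop_through b (iter i b.1 j)) =
  join (rot i [seq pieces b k | k <- orbit b.1 j]).
Proof. by move=> il; rewrite wedges_loop_through orbit_iter // map_rot. Qed.

Lemma through_class j k : froot b.1 j = froot b.1 k ->
  loop_class (through j) = loop_class (through k).
Proof.
move=> /(fingraph.rootP (perm_connect_sym _)) => jk.
apply/loop_classP; have := through_iter (ltnW (findex_max jk)).
rewrite iter_findex // => ek.
have [i ei] := rot_join (findex b.1 j k) [seq pieces b k | k <- orbit b.1 j].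
by exists i; rewrite [LHS]ek ei -wedges_loop_through.
Qed.

(** Passes from the edges of a loop to the indices of the cycle that produced it. *)
Lemma flatten_rot_through (X : Type) (Q : seq E -> seq X) j :
  (forall z, ~~ starts_excursion F1 F2 z -> Q z = [::]) ->
  flatten [seq Q a | a <- rotations (wedges (loop_through b j))] =
  flatten [seq Q (wedges (loop_through b k)) | k <- orbit b.1 j].
Proof.
move=> Q0; rewrite /rotations -map_comp wedges_loop_through.
rewrite (@flatten_rot_join _ F1 F2) //.
- rewrite size_map size_orbit; congr flatten; apply: (@eq_from_nth _ [::]).
    by rewrite !size_map size_iota size_orbit.
  move=> i; rewrite size_map size_iota => il.
  rewrite (nth_map 0) ?size_iota // nth_iota // (nth_map j) ?size_orbit //.
  by rewrite nth_traject // add0n through_iter ?(ltnW il).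
- by apply/allP => p /mapP[k _ ->]; exact: piece_ok_pieces.
- by rewrite -wedges_loop_through; exact: (loop_cycle (through j)).
Qed.

End Bridge.
End Concatenation.

(** * Counting the completions of a list of excursions *)

Section Completions.
Variables (G : digraph) (F1 F2 : {fset vert G}) (D : subgraph G).
Hypothesis F12 : [disjoint F1 & F2]%fset.
Local Notation E := (edge G).
Variable h : seq (walk G).
Local Notation N := (size h).
Local Notation exc := (tnth (in_tuple h)).
Implicit Types (b : ubridge G N) (j k : 'I_N).

Hypothesis walk_h : forall a, a \in h -> is_walk a.
Hypothesis exc_h : forall a, a \in h -> is_excursion F1 F2 a.

Local Notation bridges_of := (bridges_of F1 D).
Local Notation through okb := (through F12 walk_h exc_h okb).

Definition loop_of (w : walk G) : option (loop G) := omap (@loop_class G) (insub w).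

Lemma loop_of_through b (okb : bridges_of b) j :
  loop_of (loop_through b j) = Some (loop_class (through okb j)).
Proof.
rewrite /loop_of insubT /=; first exact: (loop_throughP F12 walk_h exc_h okb).
by move=> p; congr (Some (loop_class _)); exact: val_inj.
Qed.

Lemma concatenationE b (okb : bridges_of b) :
  concatenation b = seq_mset [seq loop_class (through okb j) | j <- root_seq b.1].
Proof.
rewrite /concatenation; congr seq_mset; rewrite /root_seq.
elim: (enum _) => //= j s <-.
by rewrite -/(loop_of _) loop_of_through.
Qed.

Lemma loop_through_inj b b' (okb : bridges_of b) (okb' : bridges_of b') j k :
  wedges (loop_through b j) = wedges (loop_through b' k) ->
  loop_through b j = loop_through b' k.
Proof.
by move=> e; apply: (congr1 (@loop_walk G) (@loop_wedges_inj _ (through okb j) (through okb' k) e)).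
Qed.

(** Pieces record edges only. An excursion has a first edge, which gives back its starting point; a
    bridge may have no edge, but it starts where the excursion before it ends. *)
Lemma pieces_inj b b' j k : bridges_of b -> bridges_of b' ->
  pieces b j = pieces b' k -> exc j = exc k /\ b.2 j = b'.2 k.
Proof.
move=> okb okb' [e1 e2].
have ejk : exc j = exc k.
  have := walk_h (mem_tnth j (in_tuple h)); have := walk_h (mem_tnth k (in_tuple h)).
  have := excursion_edges_size (exc_edges F12 walk_h exc_h j).
  case: (exc j) (exc k) e1 => x y [x' y'] /= <-; case: y => // e y _.
  by rewrite !is_walk_cons => /andP[/eqP -> _] /andP[/eqP -> _].
split=> //; have [_ sb _ _] := okb j; have [_ sb' _ _] := okb' k.
have : start (b.2 j) = start (b'.2 k) by rewrite sb sb' /exc_finish ejk.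
by case: (b.2 j) (b'.2 k) e2 => ? ? [? ?] /= -> ->.
Qed.

Lemma loop_through_pieces b b' j k : bridges_of b -> bridges_of b' ->
  loop_through b j = loop_through b' k ->
  [seq pieces b i | i <- orbit b.1 j] = [seq pieces b' i | i <- orbit b'.1 k].
Proof.
move=> okb okb' e; apply: (@join_inj _ F1 F2).
- by apply/allP => p /mapP[i _ ->]; exact: (piece_ok_pieces F12 walk_h exc_h okb).
- by apply/allP => p /mapP[i _ ->]; exact: (piece_ok_pieces F12 walk_h exc_h okb').
- rewrite -wedges_loop_through; have := loop_cycle (through okb j).
  rewrite -[wedges _]/(wedges (loop_through b j)).
  by case: (wedges (loop_through b j)) => //= a s; rewrite rcons_path => /andP[].
- by rewrite -!wedges_loop_through e.
Qed.

Lemma loop_through_step b b' j k : bridges_of b -> bridges_of b' ->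
  loop_through b j = loop_through b' k ->
  loop_through b (b.1 j) = loop_through b' (b'.1 k).
Proof.
move=> okb okb' e; apply: loop_through_inj => //.
have ep := loop_through_pieces okb okb' e.
by rewrite !wedges_loop_through !orbit_perm !map_rot ep.
Qed.

Lemma loop_through_order b b' j k : bridges_of b -> bridges_of b' ->
  loop_through b j = loop_through b' k -> order b.1 j = order b'.1 k.
Proof.
move=> okb okb' /(loop_through_pieces okb okb') /(congr1 size).
by rewrite !size_map !size_orbit.
Qed.

Lemma loop_through_head b b' j k : bridges_of b -> bridges_of b' ->
  loop_through b j = loop_through b' k -> exc j = exc k /\ b.2 j = b'.2 k.
Proof.
move=> okb okb' /(loop_through_pieces okb okb').
rewrite /orbit -(orderSpred b.1 j) -(orderSpred b'.1 k) /= => -[e1 e2 _]; apply: pieces_inj => //.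
by rewrite /pieces e1 e2.
Qed.

Lemma loop_of_step b j : bridges_of b ->
  loop_of (loop_through b (b.1 j)) = loop_of (loop_through b j).
Proof.
move=> okb; rewrite !loop_of_through; congr Some; apply: through_class.
exact: froot_perm.
Qed.

Lemma starts_excursion_through b j : bridges_of b ->
  starts_excursion F1 F2 (wedges (loop_through b j)).
Proof.
move=> okb; rewrite wedges_loop_through /orbit -orderSpred /= join_cons.
apply/starts_excursionP; eexists; apply: excursion_piece.
exact: exc_edges.
Qed.

(** [loop_mult] counts rotations over all edges. The target word begins with an excursion, so only
    rotations to the start of a piece can equal it, and these correspond to the indices in the
    orbit. *)
Lemma count_loop_through b b' j k : bridges_of b -> bridges_of b' ->
  loop_of (loop_through b j) = loop_of (loop_through b' k) ->
  count (fun i => loop_through b i == loop_through b' k) (orbit b.1 j) =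
  if loop_of (loop_through b' k) is Some L then loop_mult L else 0.
Proof.
move=> okb okb'; rewrite !loop_of_through => -[ecl].
rewrite -ecl -(count_rotations (esym ecl)).
(* A count written as the length of a flattened list, to fit [flatten_rot_through]. *)
pose Q z := if z == wedges (loop_through b' k) then [:: tt] else [::].
have sQ s : count_mem (wedges (loop_through b' k)) s = size (flatten (map Q s)).
  by rewrite size_flatten /shape -map_comp; elim: s => //= z s ->; rewrite /Q; case: eqP.
rewrite [RHS]sQ (flatten_rot_through F12 walk_h exc_h okb); last first.
  move=> z; rewrite /Q; case: eqP => // -> /negP[].
  exact: starts_excursion_through.
rewrite (map_comp Q) -sQ count_map; apply: eq_count => i.
rewrite -[RHS]/(wedges (loop_through b i) == wedges (loop_through b' k)).
apply/eqP/eqP => [-> //|]; exact: loop_through_inj.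
Qed.

Definition stabilizer : {set 'S_N} := [set f : 'S_N | [forall j, exc (f j) == exc j]].

(** Products of permutations act from left to right, so the new permutation sends [f j] to
    [f (b.1 j)], and the bridge of index [j] receives the index [f j]. *)
Definition relabel (f : 'S_N) b : ubridge G N :=
  ((f^-1 * b.1 * f)%g, [ffun j => b.2 (f^-1%g j)]).

Lemma stabilizerP (f : 'S_N) : reflect (forall j, exc (f j) = exc j) (f \in stabilizer).
Proof.
rewrite finset.in_set; apply: (iffP forallP) => H j; first exact/eqP.
by rewrite H.
Qed.

Lemma relabel_bridges (f : 'S_N) b : f \in stabilizer -> bridges_of b ->
  bridges_of (relabel f b).
Proof.
move=> /stabilizerP fs okb j; rewrite /= ffunE !permM.
have := okb (f^-1%g j); rewrite /exc_finish /exc_start.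
have ej : exc (f^-1%g j) = exc j by rewrite -[in RHS](permKV f j) fs.
by rewrite fs ej.
Qed.

Definition bridge_isos b b' : {set 'S_N} :=
  isomorphisms b.1 b'.1 (loop_through b) (loop_through b').

(** The loop read from [j] determines its first excursion and first bridge, so preserving colours
    preserves both; conversely a relabelling carries orbits to orbits piece by piece. *)
Lemma bridge_isosP b b' (f : 'S_N) : bridges_of b -> bridges_of b' ->
  (f \in bridge_isos b b') = (f \in stabilizer) && (relabel f b == b').
Proof.
move=> okb okb'; apply/isomorphismsP/andP => [[H1 H2]|[/stabilizerP fs /eqP fb]].
  split.
    by apply/stabilizerP => j; have [] := loop_through_head okb' okb (H2 j).
  apply/eqP; rewrite /relabel (surjective_pairing b'); congr (_, _).
    by apply/permP => j; rewrite !permM H1 permKV.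
  apply/ffunP => j; rewrite ffunE.
  by have [_ <-] := loop_through_head okb' okb (H2 (f^-1%g j)); rewrite permKV.
have fstep x : f (b.1 x) = b'.1 (f x) by rewrite -fb /= !permM permK.
split => // x; apply: loop_through_inj => //.
have fiter i y : f (iter i b.1 y) = iter i b'.1 (f y) by elim: i => //= i <-.
have oE : orbit b'.1 (f x) = map f (orbit b.1 x).
  have ordE : order b'.1 (f x) = order b.1 x.
    rewrite /order -[RHS](fintype.card_image (@perm_inj _ f)); apply: eq_card => y.
    rewrite !inE; apply/idP/fintype.imageP => [xy|[z + ->]].
      exists (iter (findex b'.1 (f x) y) b.1 x); first exact: fconnect_iter.
      by rewrite fiter iter_findex.
    by move=> /iter_findex <-; rewrite fiter; exact: fconnect_iter.
  rewrite /orbit ordE; move: (order b.1 x) => n {ordE}.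
  by elim: n (x) => //= n IH y; rewrite -IH fstep.
rewrite !wedges_loop_through oE -map_comp; congr join; apply: eq_map => k /=.
by rewrite /pieces fs -fb /= ffunE permK.
Qed.

Lemma concatenation_relabel (f : 'S_N) b : f \in stabilizer -> bridges_of b ->
  concatenation (relabel f b) = concatenation b.
Proof.
move=> fs okb; have okb' := relabel_bridges fs okb.
have /isomorphismsP[fstep fW] : f \in bridge_isos b (relabel f b).
  by rewrite bridge_isosP // fs eqxx.
rewrite !concatenationE; apply/eq_seq_msetP.
have := perm_map (fun j => loop_class (through okb' j)) (perm_root_seq_conj fstep).
rewrite perm_sym => /perm_trans; apply; rewrite -map_comp.
rewrite (eq_map (g := fun j => loop_class (through okb j))) // => j /=.
apply: Some_inj; rewrite -!loop_of_through -fW !loop_of_through; congr Some.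
by apply: through_class; rewrite froot_froot.
Qed.

(** The count is the same for all [b'] with the given concatenation, and it is positive. This yields
    transitivity of the relabellings together with the order of the stabilizers. *)
Lemma card_bridge_isos b b' (okb : bridges_of b) :
  bridges_of b' -> concatenation b = concatenation b' ->
  #|bridge_isos b b'| =
  symmetry_factor (@loop_mult G) [seq loop_class (through okb j) | j <- root_seq b.1].
Proof.
move=> okb'; rewrite !concatenationE => /eq_seq_msetP permc.
pose J (o : option (loop G)) := if o is Some L then loop_mult L else 0.
rewrite /bridge_isos (@card_isomorphisms _ _ _ _ _ _ _ loop_of J).
- have sS (ls : seq (loop G)) : symmetry_factor J (map Some ls) = symmetry_factor (@loop_mult G) ls.
    elim: ls => //= L ls ->; congr (_ * _.+1 * _)%N.
    by rewrite count_map; apply: eq_count => K /=; rewrite (inj_eq Some_inj).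
  rewrite -sS -map_comp; congr symmetry_factor; apply: eq_map => j /=.
  exact: loop_of_through.
- by move=> x y e; apply: loop_through_order.
- by move=> x y e; apply: loop_through_step.
- by move=> y; exact: loop_of_step.
- by move=> x y e; rewrite count_loop_through.
- have := perm_map Some permc; rewrite -!map_comp.
  by under eq_map => j do rewrite /= -loop_of_through;
     under [X in perm_eq _ X]eq_map => j do rewrite /= -loop_of_through.
Qed.

(** In the list of the relabellings of [b] each bridge with the same concatenation occurs equally
    often, namely [F] times; comparing lengths gives the count. *)
Lemma card_completions b (okb : bridges_of b) : exists t : seq (ubridge G N),
  [/\ uniq t,
      forall b', b' \in t <-> bridges_of b' /\ concatenation b' = concatenation b
    & (size t * symmetry_factor (@loop_mult G)
         [seq loop_class (through okb j) | j <- root_seq b.1])%N = #|stabilizer|].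
Proof.
set F := symmetry_factor _ _.
pose s := [seq relabel f b | f <- enum stabilizer].
have F0 : F != 0.
  rewrite /F; elim: [seq _ | _ <- _] => //= L ls IH.
  by rewrite !muln_eq0 !negb_or IH andbT -lt0n loop_mult_gt0.
have countE b' : bridges_of b' -> concatenation b' = concatenation b ->
    count_mem b' s = F.
  move=> okb' e; rewrite /F -(card_bridge_isos okb okb' (esym e)).
  rewrite /s count_map -sum1_count big_enum_cond /= -sum1_card; apply: eq_bigl => f.
  by rewrite bridge_isosP.
have memE b' : b' \in s <-> bridges_of b' /\ concatenation b' = concatenation b.
  split=> [/mapP[f + ->]|[okb' e]].
    rewrite mem_enum => fs; split; first exact: relabel_bridges.
    exact: concatenation_relabel.
  by rewrite -has_pred1 has_count countE // lt0n.
exists (undup s); split; first exact: undup_uniq.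
  by move=> b'; rewrite mem_undup.
rewrite -size_undup_const; first by rewrite size_map cardE.
by move=> b' /memE[okb' e]; exact: countE.
Qed.

End Completions.

(** * Rerooting invariance and the excursions of a loop *)

Section LoopInvariants.
Variables (G : digraph) (F1 F2 : {fset vert G}).
Hypothesis F12 : [disjoint F1 & F2]%fset.
Local Notation E := (edge G).
Implicit Types (l : rooted_loop G) (L : loop G).

Lemma meets_loop (F : {fset vert G}) l :
  Defs.meets F l = has (fun e => tgt e \in F) (wedges l).
Proof.
rewrite /Defs.meets /verts /= has_map orb_idl // => sF.
case/and3P: (loop_walkP l) => _; rewrite /steps /finish => + /eqP fs.
case: (wedges l) fs => // e s; rewrite /= last_map => fs _.
by have := has_rcons (fun e' => tgt e' \in F) (belast e s) (last e s);
   rewrite -lastI /= fs sF => ->.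
Qed.

Lemma loop_rep_rot l : exists i, wedges (loop_rep (loop_class l)) = rot i (wedges l).
Proof. by apply/loop_classP; rewrite loop_repK. Qed.

Lemma meets_loop_rep (F : {fset vert G}) l :
  Defs.meets F (loop_rep (loop_class l)) = Defs.meets F l.
Proof. by have [i e] := loop_rep_rot l; rewrite !meets_loop e has_rot. Qed.

Lemma in_subgraph_loop (D : subgraph G) l :
  in_subgraph D l <-> forall e, e \in wedges l -> sub_edge D e.
Proof.
split => [[]//|H]; split => // x.
have [e el ex] : exists2 e, e \in wedges l & tgt e = start l.
  case/and3P: (loop_walkP l) => _; rewrite /steps /finish.
  case: (wedges l) => // e s _ /eqP; rewrite /= last_map => fs.
  by exists (last e s); rewrite ?mem_last.
rewrite inE => /orP[/eqP ->|/mapP[e' e'l ->]].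
  by rewrite -ex; have /sub_edge_ends[] := H _ el.
by have /sub_edge_ends[] := H _ e'l.
Qed.

Lemma in_subgraph_loop_rep (D : subgraph G) l l' : loop_class l = loop_class l' ->
  in_subgraph D l -> in_subgraph D l'.
Proof.
move=> /loop_classP[i e] /in_subgraph_loop H.
by apply/in_subgraph_loop => e'; rewrite e mem_rot; exact: H.
Qed.

Lemma steps_class l l' : loop_class l = loop_class l' -> steps l = steps l'.
Proof. by move=> /loop_classP[i e]; rewrite /steps e size_rot. Qed.

Lemma vert_at_src e0 l i : i < steps l ->
  vert_at l i = src (nth e0 (wedges l) i).
Proof.
case: i => [|i] il; first by rewrite -loop_start.
rewrite sorted_consecutive //; last first.
  have := loop_cycle l; case: (wedges l) => //= e s.
  by rewrite rcons_path => /andP[].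
by rewrite /vert_at /= (nth_map e0) //; apply: ltnW.
Qed.

(** Depends on the edge word alone and is empty on words that do not start with an excursion, as
    [flatten_rot_join] demands of [Q]. *)
Definition leading_excursions (z : seq E) : seq (walk G) :=
  if z is e :: _ then
    [seq Walk (src e) (take k z) | k <- iota 1 (size z) & excursion_edges F1 F2 (take k z)]
  else [::].

Lemma loop_excursionsE l :
  loop_excursions F1 F2 l = flatten [seq leading_excursions a | a <- rotations (wedges l)].
Proof.
rewrite /loop_excursions filter_flatten -map_comp /rotations -map_comp.
congr flatten; apply/eq_in_map => i; rewrite mem_iota add0n /= => il.
have [e0 _] : exists e0 : E, true by case: (wedges l) (loop_size l) => // e0; exists e0.
have : cycle (@consecutive G) (rot i (wedges l)) by rewrite rot_cycle loop_cycle.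
have ve := vert_at_src e0 il.
have : src (nth e0 (rot i (wedges l)) 0) = vert_at l i.
  by rewrite /rot nth_cat size_drop subn_gt0 il nth_drop addn0.
have : size (rot i (wedges l)) = steps l by rewrite size_rot.
rewrite filter_map /portion; case: (rot i (wedges l)) => [|e z] /=.
  by move=> s0; rewrite -s0 in il.
move=> sz sv cz; rewrite -sz -sv; congr map; apply/eq_in_filter => k.
rewrite mem_iota => /andP[k0 _]; rewrite /= is_excursionE // -(prednK k0) /=.
rewrite is_walk_cons eqxx /=; apply: take_path.
by move: cz; rewrite rcons_path => /andP[].
Qed.

Lemma perm_loop_excursions l :
  perm_eq (loop_excursions F1 F2 (loop_rep (loop_class l))) (loop_excursions F1 F2 l).
Proof.
have [i e] := loop_rep_rot l; rewrite !loop_excursionsE e.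
exact/perm_flatten/perm_map/perm_rotations.
Qed.

End LoopInvariants.

(** * Excursions and weight of a concatenation *)

Section CompletionInvariants.
Variables (G : digraph) (F1 F2 : {fset vert G}) (D : subgraph G).
Hypothesis F12 : [disjoint F1 & F2]%fset.
Variable h : seq (walk G).
Local Notation N := (size h).
Local Notation exc := (tnth (in_tuple h)).
Hypothesis walk_h : forall a, a \in h -> is_walk a.
Hypothesis exc_h : forall a, a \in h -> is_excursion F1 F2 a.
Variable b : ubridge G N.
Hypothesis okb : bridges_of F1 D b.
Local Notation through := (through F12 walk_h exc_h okb).
Implicit Types (j k : 'I_N).

Lemma enum_concatenation :
  perm_eq (concatenation b) [seq loop_class (through j) | j <- root_seq b.1].
Proof. by rewrite (concatenationE F12 walk_h exc_h okb) perm_eq_seq_mset. Qed.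

Lemma leading_excursions_through j :
  leading_excursions F1 F2 (wedges (loop_through b j)) = [:: exc j].
Proof.
have := loop_cycle (through j); rewrite -[wedges _]/(wedges (loop_through b j)).
have e1 := exc_edges F12 walk_h exc_h j; have e2 := excursion_edges_size e1.
rewrite wedges_loop_through /orbit -(orderSpred b.1 j) /= join_cons /piece -catA.
set r := wedges (b.2 j) ++ _.
have : is_walk (exc j) by rewrite walk_h ?mem_tnth.
case ej : (exc j) e1 e2 => [x [//|e y]] /= e1 _; rewrite is_walk_cons => /andP[/eqP ex _] c.
have sz : sorted (@consecutive G) ((e :: y) ++ r).
  by move: c; rewrite ej /= rcons_path => /andP[].
have take_ey : take (size (e :: y)) ((e :: y) ++ r) = e :: y by rewrite take_size_cat.
rewrite ej -[LHS]/([seq Walk (src e) (take n ((e :: y) ++ r)) |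
  n <- iota 1 (size ((e :: y) ++ r)) & excursion_edges F1 F2 (take n ((e :: y) ++ r))]).
set z := (e :: y) ++ r in sz take_ey *.
have yz : size (e :: y) <= size z by rewrite size_cat leq_addr.
rewrite (eq_in_filter (a2 := pred1 (size (e :: y)))); last first.
  move=> k; rewrite mem_iota => /andP[k0 ks].
  apply/idP/eqP => [ek|->]; last by rewrite take_ey.
  by apply: (@excursion_prefix_uniq _ F1 F2 _ _ _ sz); rewrite ?take_ey.
rewrite filter_pred1_uniq ?iota_uniq //; last by rewrite mem_iota.
by rewrite -ex; congr [:: Walk _ _]; exact: take_ey.
Qed.

(** Each index lies in exactly one cycle, and the loop of that cycle has exactly one excursion
    starting at the corresponding piece. Hence no unordered bridge creates or destroys
    excursions. *)
Lemma perm_excursions_concatenation :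
  perm_eq (excursions F1 F2 (concatenation b)) h.
Proof.
rewrite /excursions (perm_trans (perm_flatten (perm_map _ enum_concatenation))) //.
rewrite -map_comp.
have H : {in root_seq b.1, forall j, perm_eq
    (loop_excursions F1 F2 (loop_rep (loop_class (through j)))) [seq exc k | k <- orbit b.1 j]}.
  move=> j _; rewrite (permPl (perm_loop_excursions F12 _)) loop_excursionsE //.
  rewrite -[wedges _]/(wedges (loop_through b j)).
  rewrite (flatten_rot_through F12 walk_h exc_h okb).
    rewrite (eq_map (g := fun k => [:: exc k])) ?flatten_map1 //.
    exact: leading_excursions_through.
  case=> // e z nz; rewrite /leading_excursions.
  rewrite (eq_filter (a2 := pred0)) ?filter_pred0 // => n.
  by apply/negbTE; apply: contra nz => en; apply/starts_excursionP; exists n.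
have : perm_eq [seq exc k | k <- flatten [seq orbit b.1 j | j <- root_seq b.1]] h.
  rewrite (permPl (perm_map _ (perm_flatten_root_seq _))).
  by rewrite map_tnth_enum.
apply: perm_trans; rewrite map_flatten -map_comp.
elim: (root_seq b.1) H => //= j s IH H; apply: perm_cat; first exact: H (mem_head _ _).
by apply: IH => k ks; apply: H; rewrite inE ks orbT.
Qed.

Lemma through_crossing j : Defs.meets F1 (through j) && Defs.meets F2 (through j).
Proof.
rewrite !meets_loop -[wedges _]/(wedges (loop_through b j)).
rewrite wedges_loop_through /orbit -(orderSpred b.1 j) /= join_cons /piece !has_cat.
rewrite -[(pieces b j).1]/(wedges (exc j)).
have := exc_edges F12 walk_h exc_h j; case: (wedges (exc j)) => // e z.
move=> /and4P[_ l _ h1].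
apply/andP; split; apply/orP; left; apply/orP; left; first exact: h1.
by apply/hasP; exists (last e z); rewrite ?mem_last.
Qed.

Lemma through_in_subgraph j : (forall a, a \in h -> in_subgraph D a) ->
  in_subgraph D (through j).
Proof.
move=> inD; apply/in_subgraph_loop => e; rewrite -[wedges _]/(wedges (loop_through b j)).
rewrite wedges_loop_through => /flatten_mapP[p /mapP[k _ ->]].
rewrite /piece mem_cat => /orP[|] /= ek.
  by have [_] := inD _ (mem_tnth k (in_tuple h)); exact.
by have [_ _ _ [_ H]] := okb k; have [] := H _ ek.
Qed.

Lemma steps_through j : steps (through j) =
  \sum_(k <- orbit b.1 j) (steps (exc k) + steps (b.2 k)).
Proof.
rewrite /steps -[wedges _]/(wedges (loop_through b j)) wedges_loop_through.
rewrite size_flatten sumnE !big_map; apply: eq_bigr => k _.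
by rewrite size_cat.
Qed.

(** Implies that all completions of [h] to the same loops have the same weight. *)
Lemma weight_concatenation (R : realType) g :
  (\prod_(L <- concatenation b) weight R g (loop_rep L) =
   \prod_(a <- h) weight R g a * \prod_j weight R g (b.2 j))%R.
Proof.
rewrite (perm_big _ enum_concatenation) big_map /=.
rewrite [X in (_ = X * _)%R]big_tnth -big_split /= -[RHS]big_enum /=.
rewrite -(perm_big _ (perm_flatten_root_seq b.1)) big_flatten big_map /=.
apply: eq_bigr => j _; rewrite /weight (steps_class (loop_repK _)) steps_through.
rewrite GRing.expr_sum; apply: eq_bigr => k _.
by rewrite GRing.exprD.
Qed.

End CompletionInvariants.

Import Order.TTheory GRing.Theory Num.Theory.
Local Open Scope classical_set_scope.
Local Open Scope ring_scope.

(** * The loop measure and the Poisson process *)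

Section Sums.
Context {R : realType}.
Local Open Scope ereal_scope.

Lemma esum_seq (I : choiceType) (s : seq I) (a : I -> \bar R) : uniq s ->
  (forall i, i \in s -> 0 <= a i) -> \esum_(i in [set` s]) a i = \sum_(i <- s) a i.
Proof.
move=> us a0; rewrite esum_fset; first by rewrite [RHS]fsbig_seq.
  exact: finite_seq.
by move=> i; rewrite inE; exact: a0.
Qed.

Lemma esum_subset (I : choiceType) (A B : set I) (a : I -> \bar R) :
  A `<=` B -> \esum_(i in A) a i <= \esum_(i in B) a i.
Proof.
move=> AB; apply: le_ereal_sup => _ [X [finX XA] <-].
by exists X => //; split=> //; exact: subset_trans AB.
Qed.

Lemma le_esum_inj (I J : choiceType) (A : set I) (B : set J) (f : I -> J)
    (a : J -> \bar R) : set_inj A f -> (forall i, A i -> B (f i)) ->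
  \esum_(i in A) a (f i) <= \esum_(j in B) a j.
Proof.
move=> fi fAB; rewrite -(esum_image A f a fi); apply: esum_subset.
by move=> _ [i Ai <-]; exact: fAB.
Qed.

Lemma sum_const_ereal (I : Type) (s : seq I) (c : R) :
  \sum_(i <- s) c%:E = ((size s)%:R * c)%:E.
Proof.
elim: s => [|i s IH]; first by rewrite big_nil mul0r.
by rewrite big_cons IH -EFinD /= mulrSr mulrDl mul1r addrC.
Qed.

End Sums.

Section LoopMeasure.
Variables (R : realType) (G : digraph) (g : nat) (D : subgraph G).
Local Notation E := (edge G).
Implicit Types (l : rooted_loop G) (L : loop G).

Lemma weight_ge0 (w : walk G) : 0 <= weight R g w.
Proof. by rewrite /weight exprn_ge0 // invr_ge0. Qed.

Lemma weight_class l l' : loop_class l = loop_class l' -> weight R g l = weight R g l'.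
Proof. by move=> e; rewrite /weight (steps_class e). Qed.

Lemma exists_reroot l i : exists l', wedges l' = rot i (wedges l).
Proof.
have c : cycle (@consecutive G) (rot i (wedges l)) by rewrite rot_cycle loop_cycle.
have s0 : (0 < size (rot i (wedges l)))%N by rewrite size_rot loop_size.
case: (rot i (wedges l)) c s0 => // e z c _.
have il : is_loop (Walk (src e) (e :: z)) by rewrite is_loop_cons eqxx.
by exists (RootedLoop il).
Qed.

Lemma loop_measure_ge0 A : (0 <= loop_measure R g D A)%E.
Proof.
by apply: esum_ge0 => l _; rewrite lee_fin divr_ge0 ?weight_ge0.
Qed.

Lemma loop_measure1 L : in_subgraph D (loop_rep L) ->
  loop_measure R g D [set L] = (weight R g (loop_rep L) / (loop_mult L)%:R)%:E.
Proof.
move=> LD; rewrite /loop_measure.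
pose c := weight R g (loop_rep L) / (steps (loop_rep L))%:R.
pose S := [set l : rooted_loop G | loop_class l = L /\ in_subgraph D l].
pose s := undup (rotations (wedges (loop_rep L))).
rewrite (@eq_esum _ _ _ _ (fun=> c%:E)); last first.
  by move=> l [lL _]; rewrite (weight_class (l' := loop_rep L)) ?(steps_class (l' := loop_rep L)) ?loop_repK.
rewrite -(reindex_esum S [set` s] (fun l => wedges l) (fun=> c%:E)); last first.
  split.
  - move=> l [lL _] /=; rewrite mem_undup.
    have [i ->] : exists i, wedges l = rot i (wedges (loop_rep L)).
      by apply/loop_classP; rewrite loop_repK.
    rewrite -(perm_mem (perm_rotations i _)); apply/mapP; exists 0%N; rewrite ?rot0 //.
    by rewrite mem_iota size_rot loop_size.
  - by move=> l l' _ _; exact: loop_wedges_inj.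
  - move=> a /=; rewrite mem_undup => /mapP[i _ ->].
    have [l el] := exists_reroot (loop_rep L) i; exists l => //; split.
      by rewrite -[RHS]loop_repK; apply/esym/loop_classP; exists i.
    by apply: in_subgraph_loop_rep LD; apply/loop_classP; exists i.
rewrite esum_seq ?undup_uniq // => [|i _]; last first.
  by rewrite lee_fin divr_ge0 ?weight_ge0.
rewrite sum_const_ereal; congr (_%:E); rewrite /c /steps -card_loop_class -/s natrM.
have s0 : (size s)%:R != 0 :> R.
  rewrite pnatr_eq0 size_eq0; apply/eqP => /undup_nil /(congr1 size).
  by rewrite size_rotations; have := loop_size (loop_rep L); case: (size _).
have J0 : (loop_mult L)%:R != 0 :> R by rewrite pnatr_eq0 -lt0n loop_mult_gt0.
by field; rewrite s0 J0.
Qed.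

Lemma loop_measure1_notin L : ~ in_subgraph D (loop_rep L) ->
  loop_measure R g D [set L] = 0%E.
Proof.
move=> nD; rewrite /loop_measure esum1 // => l [lL lD]; exfalso; apply: nD.
by apply: in_subgraph_loop_rep lD; rewrite loop_repK.
Qed.

Lemma loop_measureU (A B : set (loop G)) : A `&` B = set0 ->
  loop_measure R g D (A `|` B) = (loop_measure R g D A + loop_measure R g D B)%E.
Proof.
move=> AB; rewrite {1}/loop_measure (esumID [set l | A (loop_class l)]); last first.
  by move=> l _; rewrite lee_fin divr_ge0 ?weight_ge0.
congr (_ + _)%E; congr (esum _ _); apply/seteqP; split=> l /=.
- by move=> [[_ lD] Al].
- by move=> [Al lD]; split=> //; split=> //; left.
- by move=> [[[Al|Bl] lD] nAl].
- move=> [Bl lD]; split; first by split=> //; right.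
  by move=> Al; have : (A `&` B) (loop_class l) by []; rewrite AB.
Qed.

Lemma meets_loop_src (F : {fset vert G}) l :
  Defs.meets F l = has (fun e => src e \in F) (wedges l).
Proof.
case/and3P: (loop_walkP l) => /eqP ew _ /eqP fs.
rewrite /Defs.meets /verts lastI -ew has_rcons has_map orb_idl //.
rewrite -/(finish l) fs => sF.
case ewl : (wedges l) (loop_size l) => [//|e z] _.
by rewrite /= -[src e]/(src (nth e (e :: z) 0)) -ewl -loop_start sF.
Qed.

(** The bound is $\sum_{x\in F}G_D(x,x)$. Each loop is rerooted at a visit to [F]; with the shift
    recorded this is injective. *)
Lemma loop_measure_meets_lty (F : {fset vert G}) (A : set (loop G)) :
  finite_green R g D -> (forall x, x \in F -> sub_vert D x) ->
  (forall L, A L -> Defs.meets F (loop_rep L)) ->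
  (loop_measure R g D A < +oo)%E.
Proof.
move=> fG FD AF.
pose S := [set l : rooted_loop G | A (loop_class l) /\ in_subgraph D l].
pose Q := [set l : rooted_loop G | start l \in F /\ in_subgraph D l].
pose T := Q `*`` (fun l => [set` iota 0 (steps l)]).
pose a (p : rooted_loop G * nat) := (weight R g p.1 / (steps p.1)%:R)%:E.
have a_ge0 p : (0 <= a p)%E by rewrite lee_fin divr_ge0 ?weight_ge0.
(* The new root is the source of an edge that starts in [F]; outside [S] the pair is a dummy, so
   that [choice] applies. *)
have fP l : exists p : rooted_loop G * nat, S l ->
    [/\ T p, wedges p.1 = rot p.2 (wedges l) & (p.2 < steps l)%N].
  have [Sl|nSl] := pselect (S l); last by exists (l, 0%N).
  have [Al lD] := Sl.
  have : Defs.meets F l by rewrite -meets_loop_rep; exact: AF.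
  rewrite meets_loop_src => /hasP[e el eF].
  pose i := index e (wedges l).
  have il : (i < steps l)%N by rewrite /i /steps index_mem.
  have [l' el'] := exists_reroot l i; exists (l', i) => _ /=; split => //.
  have cl : loop_class l = loop_class l' by apply/loop_classP; exists i.
  split; last by rewrite /= mem_iota -(steps_class cl).
  split; last exact: in_subgraph_loop_rep cl lD.
  rewrite (loop_start e) el' /rot nth_cat size_drop subn_gt0.
  by rewrite il nth_drop addn0 nth_index.
have /choice[f fE] := fP.
have green_ge0 x : (0 <= green R g D x x)%E.
  by apply: esum_ge0 => w _; rewrite lee_fin weight_ge0.
apply: (@le_lt_trans _ _ (\sum_(x <- F) green R g D x x)%E); last first.
  by rewrite big_seq lte_sum_pinfty // => x /FD xD; exact: fG.
rewrite -(esum_seq (s := F)) ?fset_uniq // esum_esum; last first.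
  by move=> x w _ _; rewrite lee_fin weight_ge0.
pose B := [set` F : seq (vert G)] `*`` (fun x => bridges D x x).
apply: (@le_trans _ _ (\esum_(l in Q) (weight R g l)%:E)%E); last first.
  apply: (@le_esum_inj _ _ _ Q B (fun l => (start l, loop_walk l))
     (fun k => (weight R g k.2)%:E)).
    by move=> l l' _ _ [_ e]; apply: val_inj.
  move=> l [lF lD]; split => //=; split => //.
    by case/and3P: (loop_walkP l).
  by case/and3P: (loop_walkP l) => _ _ /eqP.
apply: (@le_trans _ _ (\esum_(p in T) a p)%E).
  rewrite /loop_measure -/S (@eq_esum _ _ _ _ (fun l => a (f l))); last first.
    move=> l Sl; have [_ el _] := fE l Sl; rewrite /a.
    have cl : loop_class l = loop_class (f l).1 by apply/loop_classP; exists (f l).2.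
    by rewrite (weight_class cl) (steps_class cl).
  apply: le_esum_inj => [l l' /set_mem Sl /set_mem Sl' ef|l Sl].
    have [_ e _] := fE l Sl; have [_ e' _] := fE l' Sl'.
    by apply: loop_wedges_inj; apply: (@rot_inj (f l).2); rewrite -e ef.
  by have [] := fE l Sl.
rewrite /T -(@esum_esum _ _ _ Q (fun l => [set` iota 0 (steps l)]) (fun l i => a (l, i))) //.
(* The $n$ possible shifts cancel the factor $1/n$ of the loop measure. *)
apply: le_esum => l _; rewrite esum_seq ?iota_uniq // /a /= sum_const_ereal size_iota.
rewrite lee_fin mulrC divfK // pnatr_eq0 -lt0n; exact: loop_size.
Qed.

End LoopMeasure.

(** * Point probabilities of a Poisson process *)

Section PoissonPoints.
Context {R : realType} {d : measure_display} {T : measurableType d}.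
Variables (P : probability T R) (I : choiceType).
Local Open Scope ereal_scope.

(** At rate 0 the formula gives the Dirac mass at 0 because $0^0=1$; this case covers the loops that
    leave $D$. *)
Lemma poisson_prob1 (r : R) k : (0 <= r)%R ->
  poisson_prob r 0%N [set k] = (r ^+ k / k`!%:R * expR (- r))%:E.
Proof.
rewrite /poisson_prob le_eqVlt => /predU1P[<-|r0].
  rewrite ltxx diracE oppr0 expR0 mulr1; case: k => [|k].
    by rewrite expr0 fact0 divr1 mem_set.
  by rewrite expr0n /= mul0r memNset.
rewrite r0 esum_set1 ?lee_fin ?poisson_pmf_ge0 //.
by rewrite /poisson_pmf r0.
Qed.

Lemma count_in1 (N : I -> T -> nat) i w : count_in N [set i] w = (N i w)%:R%:E :> \bar R.
Proof. by rewrite /count_in esum_set1 ?lee_fin. Qed.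

Lemma count_in_eq0 (N : I -> T -> nat) A w :
  count_in N A w = 0 :> \bar R <-> forall i, A i -> N i w = 0%N.
Proof.
split=> [c0 i Ai|N0]; last by apply: esum1 => i Ai; rewrite N0.
have : (N i w)%:R%:E <= 0 :> \bar R.
  by rewrite -(count_in1 N) -c0; apply: esum_subset => _ ->.
by rewrite lee_fin (ler_nat R _ 0) leqn0 => /eqP.
Qed.

Variables (mu : set I -> \bar R) (N : I -> T -> nat).
Hypothesis mu_ge0 : forall A, 0 <= mu A.
Hypothesis muU : forall A B, A `&` B = set0 -> mu (A `|` B) = mu A + mu B.
Hypothesis ppp : poisson_point_process P mu N.

Lemma le_mu A B : A `<=` B -> mu A <= mu B.
Proof.
move=> AB; rewrite -(setDUK AB) muU ?leeDl //.
by rewrite setDIK.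
Qed.

Lemma mu_seq s A : uniq s -> mu A < +oo -> [set` s] `<=` A ->
  fine (mu A) = (fine (mu (A `\` [set` s])) + \sum_(i <- s) fine (mu [set i]))%R.
Proof.
have fin B C : mu C < +oo -> B `<=` C -> mu B \is a fin_num.
  by move=> Cfin BC; rewrite ge0_fin_numE // (le_lt_trans (le_mu BC)).
elim: s A => [|i s IH] A /=.
  by move=> _ _ _; rewrite set_nil setD0 big_nil addr0.
move=> /andP[is_ us] Afin sA.
have Ai : A i by apply: sA => /=; rewrite mem_head.
have subA : A `\ i `<=` A by exact: subDsetl.
have -> : A = [set i] `|` (A `\ i) by rewrite setDUK // => _ ->.
rewrite muU; last by rewrite setDIK.
have -> : ([set i] `|` A `\ i) `\` [set` i :: s] = (A `\ i) `\` [set` s].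
  apply/seteqP; split => x /=.
    move=> [[->|[Ax xi]]]; rewrite inE => /negP; rewrite negb_or => /andP[].
      by rewrite eqxx.
    by move=> _ /negP.
  move=> [[Ax xi] xs]; split; first by right.
  by rewrite inE => /orP[/eqP|].
rewrite fineD; [|by apply: (fin _ A) => // _ ->|exact: (fin _ A)].
rewrite (IH (A `\ i)) // ?big_cons; first by rewrite addrCA.
  exact: le_lt_trans (le_mu subA) Afin.
move=> x xs; split; first by apply: sA; rewrite /= inE xs orbT.
by move=> xi; move: xs; rewrite /= xi (negbTE is_).
Qed.

(** The possibly infinitely many conditions reduce to finitely many independent counts: one for each
    point of [s], and, at the index [ord0], the emptiness of the rest of [A]. The exponentials
    multiply up to $\exp(-\mu(A))$. *)
Lemma poisson_points_eq A (s : seq I) (k : I -> nat) :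
  uniq s -> mu A < +oo -> [set` s] `<=` A ->
  (forall i, A i -> i \notin s -> k i = 0%N) ->
  P [set w | forall i, A i -> N i w = k i] =
  (\prod_(i <- s) (fine (mu [set i]) ^+ k i / (k i)`!%:R) * expR (- fine (mu A)))%:E.
Proof.
move=> us Afin sA k0; have [_ P1 Pn] := ppp.
pose B (j : 'I_(size s).+1) := if unlift ord0 j is Some j' then [set tnth (in_tuple s) j']
  else A `\` [set` s].
pose c (j : 'I_(size s).+1) := if unlift ord0 j is Some j' then k (tnth (in_tuple s) j') else 0%N.
have BA j : B j `<=` A.
  rewrite /B; case: unliftP => [j' _ _ ->|_]; last exact: subDsetl.
  exact/sA/mem_tnth.
have Bfin j : mu (B j) < +oo by exact: le_lt_trans (le_mu (BA j)) Afin.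
have Btriv i j : i != j -> B i `&` B j = set0.
  rewrite /B; case: unliftP => [i' ->|->]; case: unliftP => [j' ->|->] //.
  - rewrite (inj_eq lift_inj) => ij; apply/seteqP; split=> // x [/= -> e].
    by move: ij; rewrite -(inj_eq (elimT (tuple_uniqP (in_tuple s)) us)) e eqxx.
  - by move=> _; apply/seteqP; split=> // x [/= -> [_]]; apply; exact: mem_tnth.
  - by move=> _; apply/seteqP; split=> // x [/= [_ xs] e]; apply: xs; rewrite e; exact: mem_tnth.
have := Pn _ B c Btriv Bfin.
have -> : [set w | forall i, count_in N (B i) w = (c i)%:R%:E :> \bar R]%classic =
    [set w | forall i, A i -> N i w = k i]%classic.
  apply/seteqP; split => w /= H.
    move=> i Ai; have [/seq_tnthP[j e]|is_] := boolP (i \in s).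
      have := H (lift ord0 j); rewrite /B /c liftK -e count_in1.
      by move=> [] /eqP; rewrite eqr_nat => /eqP.
    rewrite k0 //; have := H ord0; rewrite /B /c unlift_none => /count_in_eq0.
    by apply; split => //; apply/negP.
  move=> j; rewrite /B /c; case: unliftP => [j' _|_].
    by rewrite count_in1 H //; exact/sA/mem_tnth.
  by apply/count_in_eq0 => i [Ai /negP is_]; rewrite H // k0.
move=> ->.
have PE j : P [set w | count_in N (B j) w = (c j)%:R%:E :> \bar R] =
    (fine (mu (B j)) ^+ c j / (c j)`!%:R * expR (- fine (mu (B j))))%:E.
  by rewrite (P1 _ (c j) (Bfin j)).2 poisson_prob1 // fine_ge0.
rewrite (eq_bigr _ (fun j _ => PE j)).
rewrite prodEFin; congr (_%:E); rewrite big_ord_recl /B /c unlift_none.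
rewrite expr0 fact0 divr1 mul1r.
rewrite (eq_bigr (fun j => fine (mu [set tnth (in_tuple s) j]) ^+ k (tnth (in_tuple s) j) /
    (k (tnth (in_tuple s) j))`!%:R * expR (- fine (mu [set tnth (in_tuple s) j])))%R); last first.
  by move=> j _; rewrite liftK.
rewrite big_split /= -(big_tnth _ _ s predT (fun i => fine (mu [set i]) ^+ k i / (k i)`!%:R)%R).
rewrite -(big_tnth _ _ s predT (fun i => expR (- fine (mu [set i])))).
by rewrite -expR_sum mulrCA -expRD (mu_seq us Afin sA) opprD -sumrN.
Qed.

End PoissonPoints.

(** * Law of the crossing loops *)

Section CrossingLoops.
Variables (G : digraph) (F1 F2 : {fset vert G}).
Implicit Types (L : loop G) (m : {mset (loop G)}%mset) (c : loop G -> nat).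

Definition crossing : set (loop G) :=
  [set L | Defs.meets F1 (loop_rep L) && Defs.meets F2 (loop_rep L)].

Lemma crossing_loopsE c L :
  crossing_loops F1 F2 c L =
  if L \in fset_set [set L | crossing L /\ (0 < c L)%N] then c L else 0%N.
Proof.
rewrite /crossing_loops fsfunE; congr (if _ \in fset_set _ then _ else _).
by apply/seteqP; split => K /= => [[? ? ?]|[/andP[? ?] ?]]; split => //; apply/andP.
Qed.

Lemma crossing_loops_crossing c L : L \in crossing_loops F1 F2 c -> crossing L.
Proof.
rewrite in_mset crossing_loopsE; case: ifP => // LA _.
have [fin|infin] := pselect (finite_set [set L | crossing L /\ (0 < c L)%N]).
  by move: LA; rewrite in_fset_set // inE => -[].
by move: LA; rewrite /fset_set; case: pselect.
Qed.

(** The value [mset0] is excluded because it is also the default when infinitely many crossing loops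
    are present. *)
Lemma crossing_loops_eq c m : m != mset0%mset -> (forall L, L \in m -> crossing L) ->
  crossing_loops F1 F2 c = m <-> forall L, crossing L -> c L = m L.
Proof.
move=> m0 mA; set A := [set L | crossing L /\ (0 < c L)%N].
split=> [cm|cm].
  have finA : finite_set A.
    apply: contrapT => infA; move/eqP: m0; apply; rewrite -cm.
    apply/msetP => L; rewrite crossing_loopsE -/A mset0E /fset_set.
    by case: pselect.
  move=> L AL; rewrite -cm crossing_loopsE -/A; case: ifP => //.
  rewrite in_fset_set //; case: (posnP (c L)) => // cL /negP[].
  by rewrite inE.
have finA : finite_set A.
  apply: (@sub_finite_set _ _ [set` finsupp m]); last exact: finite_fset.
  by move=> L [AL cL] /=; rewrite msuppE in_mset -cm.
apply/msetP => L; rewrite crossing_loopsE -/A in_fset_set //.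
case: ifPn => [|]; first by rewrite inE => -[/cm].
rewrite notin_setE => nA; apply/esym/mset_eq0P; apply/negP => Lm; apply: nA.
by split; [exact: mA|rewrite cm ?mset_gt0 //; exact: mA].
Qed.

Context {R : realType} {d : measure_display} {T : measurableType d}.
Variables (P : probability T R) (g : nat) (D : subgraph G).
Hypothesis green_fin : finite_green R g D.
Hypothesis F1_D : forall x, x \in F1 -> sub_vert D x.
Variable soup : loop G -> T -> nat.
Hypothesis soup_poisson : poisson_point_process P (loop_measure R g D) soup.
Local Notation mu := (loop_measure R g D).
Local Notation Lbar := (fun w => crossing_loops F1 F2 (fun L => soup L w)).

Lemma prob_crossing_loops_mu m : m != mset0%mset -> (forall L, L \in m -> crossing L) ->
  P [set w | Lbar w = m] =
  (\prod_(L <- undup m) (fine (mu [set L]) ^+ m L / (m L)`!%:R) *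
     expR (- fine (mu crossing)))%:E.
Proof.
move=> m0 mA.
have -> : [set w | Lbar w = m] = [set w | forall L, crossing L -> soup L w = m L].
  apply/seteqP; split => w /=; by rewrite crossing_loops_eq.
apply: (poisson_points_eq (mu := mu)) => //.
- exact: loop_measure_ge0.
- exact: loop_measureU.
- exact: undup_uniq.
- by apply: (loop_measure_meets_lty (F := F1)) => // L /andP[].
- by move=> L /=; rewrite mem_undup; exact: mA.
- by move=> L _; rewrite mem_undup => /mset_eq0P.
Qed.

(** The soup is indexed by all loops of the graph; a loop outside [D] has intensity 0, and a
    positive power of 0 kills the probability. *)
Lemma crossing_loops_in_subgraph m : m != mset0%mset ->
  (forall L, L \in m -> crossing L) ->
  P [set w | Lbar w = m] != 0%E ->
  forall L, L \in m -> in_subgraph D (loop_rep L).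
Proof.
move=> m0 mA; rewrite prob_crossing_loops_mu // => + L Lm; apply: contra_neqP => nD.
congr (_%:E); rewrite (bigD1_seq L) ?mem_undup ?undup_uniq //=.
rewrite loop_measure1_notin //= expr0n mset_eq0 Lm /=.
by rewrite !mul0r.
Qed.

Lemma prob_crossing_loops m : m != mset0%mset ->
  (forall L, L \in m -> crossing L) ->
  (forall L, L \in m -> in_subgraph D (loop_rep L)) ->
  P [set w | Lbar w = m] =
  (expR (- fine (mu crossing)) * \prod_(L <- m) weight R g (loop_rep L) /
     (symmetry_factor (@loop_mult G) m)%:R)%:E.
Proof.
move=> m0 mA mD; rewrite prob_crossing_loops_mu // mulrC -mulrA; congr (_ * _)%:E.
rewrite symmetry_factorE natr_prod -prodfV big_mset /=.
rewrite -(perm_big _ (perm_undup_mset m)) -big_split /=.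
rewrite big_seq [RHS]big_seq; apply: eq_bigr => L; rewrite mem_undup => Lm.
rewrite loop_measure1 /=; last exact: mD.
rewrite [count _ _](count_mem_mset L m) natrM natrX.
by rewrite expr_div_n invfM mulrA.
Qed.

End CrossingLoops.

(** * The unordered bridge measure *)

Section EsumProducts.
Context {R : realType}.
Local Open Scope ereal_scope.

(** One inequality holds for each finite partial sum; the other is the same inequality for
    $c^{-1}$. *)
Lemma esumZl (I : choiceType) (A : set I) (c : R) (a : I -> \bar R) : (0 <= c)%R ->
  (forall i, 0 <= a i) ->
  \esum_(i in A) (c%:E * a i) = c%:E * \esum_(i in A) a i.
Proof.
have le_mule (k : R) (f : I -> \bar R) : (0 <= k)%R -> (forall i, 0 <= f i) ->
    \esum_(i in A) (k%:E * f i) <= k%:E * \esum_(i in A) f i.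
  move=> k0 f0; apply: ge_ereal_sup => _ [X [finX XA] <-].
  rewrite -ge0_mule_fsumr //; apply: lee_wpmul2l; first by rewrite lee_fin.
  by apply: ereal_sup_ubound; exists X.
rewrite le_eqVlt => /predU1P[<-|c0] a0.
  by rewrite mul0e esum1 // => i _; rewrite mul0e.
apply/eqP; rewrite eq_le le_mule ?(ltW c0) //=.
rewrite -lee_pdivlMl // -[leLHS](@eq_esum _ _ _ (fun i => c^-1%:E * (c%:E * a i))).
  by apply: le_mule => [|i]; rewrite ?invr_ge0 ?(ltW c0) // mule_ge0 // lee_fin ltW.
by move=> i _; rewrite muleA -EFinM mulVf ?mul1e // gt_eqF.
Qed.

(** Tonelli after splitting off the coordinate [ord0]; an infinite factor would be sent to 0 by
    [fine]. *)
Lemma esum_ffun (U : choiceType) n (B : 'I_n -> set U) (a : 'I_n -> U -> R) :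
  (forall j u, (0 <= a j u)%R) ->
  (forall j, \esum_(u in B j) (a j u)%:E < +oo) ->
  \esum_(f in [set f : {ffun 'I_n -> U} | forall j, B j (f j)]) (\prod_j a j (f j))%:E =
  (\prod_j fine (\esum_(u in B j) (a j u)%:E))%:E.
Proof.
elim: n B a => [|n IH] B a a0 Bfin.
  rewrite big_ord0 (_ : [set f | _] = [set (ffun0 (card_ord 0) : {ffun 'I_0 -> U})]).
    by rewrite esum_set1 big_ord0 ?lee_fin.
  apply/seteqP; split => f /= _; last by move=> [].
  by apply/ffunP => -[].
pose B' j := B (lift ord0 j); pose a' j := a (lift ord0 j).
pose S' := [set f : {ffun 'I_n -> U} | forall j, B' j (f j)]%classic.
pose e (p : U * {ffun 'I_n -> U}) : {ffun 'I_n.+1 -> U} :=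
  [ffun j => if unlift ord0 j is Some j' then p.2 j' else p.1].
have e0 p : e p ord0 = p.1 by rewrite ffunE unlift_none.
have eS p j : e p (lift ord0 j) = p.2 j by rewrite ffunE liftK.
rewrite (reindex_esum (B ord0 `*`` (fun=> S')) _ e); last first.
  split.
  - move=> p [p1 p2] j; case: (unliftP ord0 j) => [j' ->|->]; first by rewrite eS; exact: p2.
    by rewrite e0.
  - move=> [u f] [u' f'] _ _ ef; congr (_, _).
      by have := congr1 (fun k : {ffun _} => k ord0) ef; rewrite !e0.
    apply/ffunP => j.
    by have := congr1 (fun k : {ffun _} => k (lift ord0 j)) ef; rewrite !eS.
  - move=> f fB; exists (f ord0, [ffun j => f (lift ord0 j)]).
      by split; [exact: fB|move=> j; rewrite ffunE; exact: fB].
    apply/ffunP => j; rewrite ffunE /=; case: (unliftP ord0 j) => [j' ->|-> //].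
    by rewrite ffunE.
have IH' := IH B' a' (fun j => a0 _) (fun j => Bfin _).
have pa0 f : (0 <= \prod_j a' j (f j))%R by apply: prodr_ge0 => j _; exact: a0.
pose c := (\prod_j fine (\esum_(u in B' j) (a' j u)%:E))%R.
transitivity (\esum_(u in B ord0) \esum_(f in S') ((a ord0 u)%:E * (\prod_j a' j (f j))%:E)).
  rewrite esum_esum => [|u f _ _]; last by rewrite -EFinM lee_fin mulr_ge0.
  apply: eq_esum => p _; rewrite big_ord_recl e0 EFinM; congr (_ * _%:E).
  by apply: eq_bigr => j _; rewrite eS.
rewrite (@eq_esum _ _ _ _ (fun u => c%:E * (a ord0 u)%:E)); last first.
  move=> u _; rewrite esumZl //; first by rewrite IH' muleC.
  by move=> f; rewrite lee_fin.
rewrite esumZl; [|by apply: prodr_ge0 => j _; apply: fine_ge0; apply: esum_ge0 => u _; rewrite lee_fin; exact: a0|by move=> u; rewrite lee_fin].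
rewrite big_ord_recl EFinM fineK; first by rewrite muleC.
by rewrite ge0_fin_numE //; apply: esum_ge0 => u _; rewrite lee_fin.
Qed.
End EsumProducts.

Section UnorderedBridgeMeasure.
Variables (R : realType) (G : digraph) (g : nat).
Hypothesis out_degree :
  forall x : vert G, ([set e : edge G | src e = x] #= `I_g)%card.
Variables (D : subgraph G) (n : nat) (X Y : 'I_n -> vert G).
Hypothesis green_fin : forall j k, (green R g D (X j) (Y k) < +oo)%E.
Implicit Types (b : ubridge G n).

(** A walk with a step exhibits an edge, so [g] is positive; a walk without steps has weight 1 for
    any [g]. *)
Lemma weight_gt0 (w : walk G) : 0 < weight R g w.
Proof.
case: w => x [|e s]; first by rewrite /weight expr0.
have g0 : (0 < g)%N.
  rewrite lt0n; apply: contraT; rewrite negbK => /eqP g0.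
  have := out_degree (src e); rewrite g0 II0 card_eq0 => /eqP/seteqP[/(_ e)].
  by case.
by rewrite exprn_gt0 // invr_gt0 ltr0n.
Qed.

Lemma green_ge0 x y : (0 <= green R g D x y)%E.
Proof. by apply: esum_ge0 => w _; rewrite lee_fin ltW ?weight_gt0. Qed.

Lemma green_gt0 j k w : bridges D (X j) (Y k) w -> 0 < fine (green R g D (X j) (Y k)).
Proof.
move=> bw; apply: fine_gt0; rewrite green_fin andbT.
apply: (@lt_le_trans _ _ (weight R g w)%:E); first by rewrite lte_fin weight_gt0.
rewrite -(@esum_set1 _ _ w (fun v => (weight R g v)%:E)).
  by apply: esum_subset => _ ->.
by rewrite lee_fin ltW ?weight_gt0.
Qed.

Definition bridges_weight b : R := \prod_j weight R g (b.2 j).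

Local Notation Z := (\sum_(s : 'S_n) perm_weight R g D X Y s).

Lemma esum_bridges_weight : (\esum_(b in ubridges D X Y) (bridges_weight b)%:E = Z%:E)%E.
Proof.
transitivity (\esum_(s in [set: 'S_n]) \esum_(f in [set f : {ffun 'I_n -> walk G} |
    forall j, bridges D (X j) (Y (s j)) (f j)]) (\prod_j weight R g (f j))%:E)%E.
  rewrite esum_esum => [|s f _ _]; last by rewrite lee_fin prodr_ge0 // => j _; exact/ltW/weight_gt0.
  congr esum; apply/seteqP; split => -[s f] /=; first by split.
  by case.
rewrite (@eq_esum _ _ _ _ (fun s => (perm_weight R g D X Y s)%:E)); last first.
  move=> s _; rewrite (@esum_ffun _ _ n (fun j => bridges D (X j) (Y (s j))) (fun=> weight R g)) //.
    by move=> _ w; exact/ltW/weight_gt0.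
  by move=> j; exact: green_fin.
rewrite [X in esum X _](_ : _ = [set` enum 'S_n]); last first.
  by apply/seteqP; split => // s _ /=; rewrite mem_enum.
rewrite esum_seq ?enum_uniq //.
  by rewrite sumEFin big_enum.
move=> s _; rewrite lee_fin prodr_ge0 // => j _; exact/fine_ge0/green_ge0.
Qed.

(** The Green's functions that weight the permutation cancel those normalizing the bridges, which
    are nonzero because the bridges of [b] exist. *)
Lemma ubridge_probE b : ubridges D X Y b ->
  ubridge_prob R g D X Y b = bridges_weight b / Z.
Proof.
move=> okb; rewrite /ubridge_prob /perm_prob /perm_weight.
have -> : \prod_(j < n) bridge_prob R g D (X j) (Y (b.1 j)) (b.2 j) =
   bridges_weight b / \prod_(j < n) fine (green R g D (X j) (Y (b.1 j))).
  rewrite -prodfV -big_split /=; apply: eq_bigr => j _.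
  by rewrite /bridge_prob; case: asboolP => // /(_ (okb j)).
rewrite mulrC mulrA divfK //.
by apply: lt0r_neq0; apply: prodr_gt0 => j _; exact: green_gt0 (okb j).
Qed.

Lemma ubridge_prob0 b : ~ ubridges D X Y b -> ubridge_prob R g D X Y b = 0.
Proof.
move=> nb; have [j nj] : exists j, ~ bridges D (X j) (Y (b.1 j)) (b.2 j).
  by apply: contrapT => H; apply: nb => j; apply: contrapT => nj; apply: H; exists j.
rewrite /ubridge_prob (bigD1 j) //= /bridge_prob; case: asboolP => // _.
by rewrite mul0r mulr0.
Qed.

Lemma ubridge_measureE (A : set (ubridge G n)) :
  ubridge_measure R g D X Y A =
  (\esum_(b in ubridges D X Y `&` A) (bridges_weight b / Z)%:E)%E.
Proof.
rewrite /ubridge_measure esum_mkcondl; apply: eq_esum => b _.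
case: ifPn => [|]; first by rewrite inE => /ubridge_probE ->.
by rewrite notin_setE => /ubridge_prob0 ->.
Qed.

End UnorderedBridgeMeasure.

(** * Conditional distributions *)

Section CountableValues.
Context {R : realType} {d : measure_display} {T : measurableType d}.
Variable P : probability T R.
Variables (S : choiceType) (X : T -> S) (M : set S).
Hypothesis mX : forall C : set S, measurable (X @^-1` C).
Hypothesis countM : countable M.
Hypothesis XM : forall w, M (X w).
Local Open Scope ereal_scope.

(** An injective numbering of the values makes the fibres a sequence, as countable additivity of [P]
    and of the integral requires. *)
Let index := projT1 (cid (elimT (countable_injP M) countM)).

Let index_inj : set_inj M index.
Proof. by rewrite /index; case: cid. Qed.

Let fiber (C : set S) k := X @^-1` [set s | C s /\ index s = k].

Let fiberE (C : set S) s : M s -> C s -> fiber C (index s) = X @^-1` [set s].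
Proof.
move=> Ms Cs; rewrite /fiber; apply/seteqP; split => w /= => [[_ e]|-> //].
by apply: index_inj; rewrite ?inE.
Qed.

Let bigcup_fiber C : \bigcup_k fiber C k = X @^-1` C.
Proof.
apply/seteqP; split=> w /=; first by move=> [k _ []].
by move=> Cw; exists (index (X w)).
Qed.

Let trivIset_fiber C : trivIset setT (fiber C).
Proof. by move=> i j _ _ [w [[_ <-] [_ <-]]]. Qed.

Let esum_fiber (C : set S) (a : set T -> \bar R) : a set0 = 0 -> (forall B, 0 <= a B) ->
  \sum_(k <oo) a (fiber C k) = \esum_(s in M `&` C) a (X @^-1` [set s]).
Proof.
move=> a0 age0; rewrite nneseries_esumT //.
transitivity (\esum_(k in index @` (M `&` C)) a (fiber C k)).
  rewrite [RHS]esum_mkcond; apply: eq_esum => k _; case: ifPn => //.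
  rewrite notin_setE => nk; rewrite (_ : fiber C k = set0) //.
  apply/seteqP; split => // w [Cw kw]; apply: nk.
  by exists (X w).
rewrite (esum_image (M `&` C) index (fun k => a (fiber C k))); last first.
  by move=> s s' /set_mem[Ms _] /set_mem[Ms' _]; apply: index_inj; rewrite inE.
by apply: eq_esum => s [Ms Cs]; rewrite fiberE.
Qed.

Lemma probability_fibers (C : set S) (B : set T) : measurable B ->
  P (X @^-1` C `&` B) = \esum_(s in M `&` C) P (X @^-1` [set s] `&` B).
Proof.
move=> mB; rewrite -bigcup_fiber setI_bigcupl measure_bigcup.
- rewrite -(@esum_fiber C (fun A => P (A `&` B))) ?set0I //.
  by apply: eq_eseriesl => k; rewrite mem_set.
- by move=> k _; apply: measurableI => //; exact: mX.
- by apply: trivIset_setIr; exact: trivIset_fiber.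
Qed.

Lemma integral_fibers (C : set S) (K : S -> \bar R) : (forall s, 0 <= K s) ->
  \int[P]_(w in X @^-1` C) K (X w) = \esum_(s in M `&` C) (K s * P (X @^-1` [set s])).
Proof.
move=> K0; rewrite -bigcup_fiber ge0_integral_bigcup.
- rewrite (@esum_fiber C (fun A => \int[P]_(w in A) K (X w))) ?integral_set0 //; last first.
    by move=> B; exact: integral_ge0.
  apply: eq_esum => s _; rewrite -integral_cst //.
  by apply: eq_integral => w; rewrite inE => /= ->.
- by move=> k; exact: mX.
- move=> mA Y mY; apply: measurableI => //.
  exact: (mX (K @^-1` Y)).
- by move=> w _; exact: K0.
- exact: trivIset_fiber.
Qed.

Lemma conditional_distribution_fibers (U : Type) (Y : T -> U) (K : S -> set U -> \bar R) :
  (forall A : set U, measurable (Y @^-1` A)) ->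
  (forall s A, 0 <= K s A) ->
  (forall s A, M s -> P (X @^-1` [set s] `&` Y @^-1` A) = K s A * P (X @^-1` [set s])) ->
  conditional_distribution P X Y K.
Proof.
move=> mY K0 KP; split => // C A.
rewrite probability_fibers // (integral_fibers C (K := K ^~ A)) //.
by apply: eq_esum => s [Ms _]; exact: KP.
Qed.

End CountableValues.

Lemma conditional_distribution1 {R : realType} {d : measure_display}
    {T : measurableType d} (P : probability T R) (S U : Type) (X : T -> S) (Y : T -> U)
    (K : S -> set U -> \bar R) s A :
  conditional_distribution P X Y K ->
  (P (X @^-1` [set s] `&` Y @^-1` A) = K s A * P (X @^-1` [set s]))%E.
Proof.
move=> [mX mY ->]; rewrite -integral_cst //.
by apply: eq_integral => w; rewrite inE => /= ->.
Qed.

Lemma countable_image (T U : Type) (f : T -> U) (A : set T) :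
  countable A -> countable (f @` A).
Proof. exact/sub_countable/card_image_le. Qed.

(** * Countability of the set of realizations *)

Section Countability.
Variables (G : digraph) (g : nat).
Hypothesis out_degree :
  forall x : vert G, ([set e : edge G | src e = x] #= `I_g)%card.

(** The graph itself may be uncountable. Starting from a finite set, the walks with one more step
    are obtained by choosing a last edge among finitely many. *)
Lemma countable_walks_from (F : {fset vert G}) :
  countable [set w : walk G | is_walk w /\ start w \in F].
Proof.
pose W n := [set w : walk G | [/\ is_walk w, start w \in F & steps w = n]].
have -> : [set w : walk G | is_walk w /\ start w \in F] = \bigcup_n W n.
  apply/seteqP; split => w /=; first by move=> [? ?]; exists (steps w).
  by move=> [n _ []].
apply: bigcup_countable; first exact: countableP.
move=> n _; elim: n => [|n IH].
  apply: (@sub_countable _ _ _ [set Walk x [::] | x in [set` F]]).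
    apply: subset_card_le => -[x s] [_ /= xF]; rewrite /steps /= => /size0nil ->.
    by exists x.
  exact/countable_image/countable_fset.
pose X := \bigcup_(w in W n) [set Walk (start w) (rcons (wedges w) e) |
  e in [set e : edge G | src e = finish w]].
apply: (@sub_countable _ _ _ X).
  apply: subset_card_le => -[x s] [/= ws xF].
  case/lastP: s ws => [//|s e]; rewrite /steps size_rcons /= -cats1 is_walk_cat.
  move=> /andP[ws we] [sn]; exists (Walk x s) => //=.
  exists e; last by rewrite cats1.
  by move: we; rewrite is_walk_cons => /andP[/eqP].
apply: bigcup_countable => // w _; apply: countable_image.
by apply: finite_set_countable; exists g.
Qed.

Lemma countable_crossing (F1 F2 : {fset vert G}) : countable (crossing F1 F2).
Proof.
pose Y := [set l : rooted_loop G | start l \in F1].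
have cY : countable Y.
  have /countable_injP[f fi] := countable_walks_from F1.
  have YW l : Y l -> loop_walk l \in [set w : walk G | is_walk w /\ start w \in F1].
    by move=> lF; rewrite inE; split => //; case/and3P: (loop_walkP l).
  apply/countable_injP; exists (f \o @loop_walk G) => l l' /set_mem lF /set_mem lF' e.
  by apply: val_inj; apply: fi => //; exact: YW.
apply: (@sub_countable _ _ _ (@loop_class G @` Y)); last exact: countable_image.
apply: subset_card_le => L /andP[+ _]; rewrite meets_loop_src => /hasP[e eL eF].
have [l' el'] := exists_reroot (loop_rep L) (index e (wedges (loop_rep L))).
exists l'.
  rewrite /Y /= (loop_start e) el' /rot nth_cat size_drop subn_gt0 index_mem eL.
  by rewrite nth_drop addn0 nth_index.
by rewrite -[RHS]loop_repK; apply/esym/loop_classP; eexists; exact: el'.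
Qed.

Lemma countable_msets (I : choiceType) (A : set I) : countable A ->
  countable [set m : {mset I}%mset | forall i, i \in m -> A i].
Proof.
move=> /countable_injP[f fi]; apply/countable_injP.
exists (fun m => choice.pickle [seq f i | i <- enum_mset m]) => m m'.
rewrite !inE /= => mA mA' /(pcan_inj choice.pickleK) e.
suff em : enum_mset m = enum_mset m'.
  by rewrite -(seq_mset_id m) -(seq_mset_id m') em.
have : {in enum_mset m, forall i, A i} by move=> i; exact: mA.
have : {in enum_mset m', forall i, A i} by move=> i; exact: mA'.
elim: (enum_mset m) (enum_mset m') e => [|i s IH] [|i' s'] //= [fe e] s'A sA.
congr (_ :: _); first by apply: fi fe; rewrite inE; [apply: sA|apply: s'A]; rewrite mem_head.
by apply: IH => // j js; [apply: s'A|apply: sA]; rewrite inE js orbT.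
Qed.

End Countability.

Lemma perm_symmetry_factor (C : eqType) (J : C -> nat) (s t : seq C) :
  perm_eq s t -> symmetry_factor J s = symmetry_factor J t.
Proof.
move=> st; rewrite !symmetry_factorE (perm_big _ (perm_undup (perm_mem st))) /=.
by apply: eq_bigr => L _; rewrite (seq.permP st).
Qed.

Lemma uniform_on_seq {R : realType} (U : choiceType) (t : seq U) (S A : set U) :
  uniq t -> (forall x, x \in t <-> S x) ->
  uniform_on S A = ((count (fun x => `[< A x >]) t)%:R / (size t)%:R : R)%:E.
Proof.
have cardE (s : seq U) : uniq s -> #|` fset_set [set` s]| = size s.
  move=> us; have -> : [set` s] = [set` [fset x in s]%fset].
    by apply/seteqP; split => x /=; rewrite in_fset.
  by rewrite set_fsetK card_fseq undup_id.
move=> ut tS; have -> : S = [set` t] by apply/seteqP; split => x /=; rewrite tS.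
rewrite /uniform_on cardE //; have -> : [set` t] `&` A = [set` [seq x <- t | `[< A x >]]].
  apply/seteqP; split => x /=; rewrite mem_filter; first by move=> [-> /asboolP ->].
  by move=> /andP[/asboolP].
by rewrite cardE ?filter_uniq // size_filter.
Qed.

Lemma ubridge_measure_ge0 (R : realType) (G : digraph) g (D : subgraph G) n
  (X Y : 'I_n -> vert G) A : (0 <= ubridge_measure R g D X Y A)%E.
Proof.
have gge0 x y : 0 <= fine (green R g D x y).
  by apply: fine_ge0; apply: esum_ge0 => w _; rewrite lee_fin weight_ge0.
apply: esum_ge0 => b _; rewrite lee_fin /ubridge_prob mulr_ge0 //.
  apply: divr_ge0; first exact: prodr_ge0.
  by apply: sumr_ge0 => s _; exact: prodr_ge0.
apply: prodr_ge0 => j _; rewrite /bridge_prob; case: ifP => // _.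
by rewrite divr_ge0 ?weight_ge0.
Qed.

(** * Joint law of the excursions and the unordered bridge *)

Section ConditionalLaw.
Variables (G : digraph) (g : nat).
Hypothesis out_degree :
  forall x : vert G, ([set e : edge G | src e = x] #= `I_g)%card.
Variables (R : realType) (D : subgraph G).
Hypothesis green_fin : finite_green R g D.
Variables F1 F2 : {fset vert G}.
Hypothesis F1_D : forall x, x \in F1 -> sub_vert D x.
Hypothesis F2_D : forall x, x \in F2 -> sub_vert D x.
Hypothesis F12 : [disjoint F1 & F2]%fset.
Local Notation D1 := (remove_vertices D F1).
Local Notation w_ := (weight R g).

Lemma loop_excursionP (l : rooted_loop G) a : a \in loop_excursions F1 F2 l ->
  [/\ is_walk a, is_excursion F1 F2 a & in_subgraph D (loop_walk l) -> in_subgraph D a].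
Proof.
move=> al; have : is_excursion F1 F2 a by move: al; rewrite mem_filter => /andP[].
move: al; rewrite loop_excursionsE // => /flatten_mapP[z /mapP[i _ zE]].
have : cycle (@consecutive G) z by rewrite zE rot_cycle loop_cycle.
case: z zE => // e z zE cz /mapP[k kz ->] exc_a; split => //.
  move: kz; rewrite mem_filter mem_iota => /and3P[_ k0 _].
  rewrite -(prednK k0) /= is_walk_cons eqxx; apply: take_path.
  by move: cz; rewrite /= rcons_path => /andP[].
move=> lD; have eD e' : e' \in e :: z -> sub_edge D e'.
  by rewrite zE mem_rot; exact: (in_subgraph_loop D l).1.
have kD e' : e' \in take k (e :: z) -> sub_edge D e' by move=> /mem_take; exact: eD.
split => //= x; rewrite inE => /orP[/eqP ->|/mapP[e' /kD e'D ->]].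
  by have /sub_edge_ends[] := eD e (mem_head _ _).
by have /sub_edge_ends[] := e'D.
Qed.

Lemma green_remove_lty x y : x \in F2 -> y \in F2 -> (green R g D1 x y < +oo)%E.
Proof.
move=> /F2_D xD /F2_D yD; apply: le_lt_trans (green_fin xD yD).
apply: esum_subset => w [ww sw fw [vw ew]]; split => //; split.
  by move=> v /vw [].
by move=> e /ew [].
Qed.

Section Completions.
Variable h : seq (walk G).
Hypothesis walk_h : forall a, a \in h -> is_walk a.
Hypothesis exc_h : forall a, a \in h -> is_excursion F1 F2 a.
Hypothesis h_D : forall a, a \in h -> in_subgraph D a.
Local Notation bridges_of := (@bridges_of G F1 D h).
Implicit Types (b : ubridge G (size h)) (m : {mset (loop G)}%mset).

Lemma bridges_weight_ge0 b : 0 <= bridges_weight R g b.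
Proof. by apply: prodr_ge0 => j _; exact: weight_ge0. Qed.

Lemma concatenation_loops b m : bridges_of b -> concatenation b = m ->
  forall L, L \in m -> crossing F1 F2 L /\ in_subgraph D (loop_rep L).
Proof.
move=> okb <- L; rewrite (perm_mem (enum_concatenation F12 walk_h exc_h okb)).
move=> /mapP[j _ ->]; split.
  by rewrite /crossing /= !meets_loop_rep; exact: through_crossing.
have inD := through_in_subgraph F12 walk_h exc_h okb j h_D.
by apply: in_subgraph_loop_rep inD; rewrite loop_repK.
Qed.

(** With $t$ completions, each one gets $\frac1t\cdot k\,w(m)/F(m)$. Since $t\,F(m)$ is the order of
    the stabilizer of $h$ and $w(m)=w(h)\,w(b)$, the factor in front of $w(b)$ is free of $m$. *)
Lemma uniform_completions (k : R) (p : \bar R) m (A : set (some_ubridge G)) :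
  0 <= k ->
  (forall b, bridges_of b -> concatenation b = m ->
     p = (k * \prod_(L <- m) w_ (loop_rep L) /
          (symmetry_factor (@loop_mult G) m)%:R)%:E) ->
  (uniform_on (completions F1 D h m) A * p =
   \esum_(b in [set b | bridges_of b /\ concatenation b = m] `&` [set b | A (as_ubridge b)])
     ((k * \prod_(a <- h) w_ a / #|stabilizer h|%:R) * bridges_weight R g b)%:E)%E.
Proof.
move=> k0 pE; set C := [set b | _ /\ _].
have [[b0 [ok0 c0]]|nC] := pselect (exists b, C b); last first.
  have C0 : C = set0 by apply/seteqP; split => // b Cb; case: nC; exists b.
  (* Without completions [uniform_on] is $0/0=0$, so both sides vanish whatever [p] is. *)
  rewrite C0 set0I esum_set0 (uniform_on_seq (t := [::])) ?mul0r ?mul0e //.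
  by move=> x; split => // -[b Cb _]; case: nC; exists b.
have [t [ut tP sizet]] := card_completions F12 walk_h exc_h ok0.
have tC b : b \in t <-> C b by rewrite tP c0.
have as_inj : injective (@as_ubridge G (size h)).
  by move=> b b' /eqP; rewrite eq_Tagged /= => /eqP.
rewrite (uniform_on_seq (t := map (@as_ubridge G (size h)) t)); last 2 first.
- by rewrite map_inj_uniq.
- move=> x; split=> [/mapP[b /tC Cb ->]|[b Cb <-]]; first by exists b.
  by apply/mapP; exists b => //; apply/tC.
have wE b : C b -> bridges_weight R g b = bridges_weight R g b0.
  move=> [okb cb]; have h0 : \prod_(a <- h) w_ a != 0.
    by apply: lt0r_neq0; apply: prodr_gt0 => a _; exact: (weight_gt0 _ out_degree).
  apply: (mulfI h0); rewrite -(weight_concatenation F12 walk_h exc_h okb) cb -c0.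
  exact: (weight_concatenation F12 walk_h exc_h ok0).
have -> : C `&` [set b | A (as_ubridge b)] =
    [set` [seq b <- t | `[< A (as_ubridge b) >]]].
  apply/seteqP; split => b /=; rewrite mem_filter; first by move=> [/tC -> /asboolP ->].
  by move=> /andP[/asboolP ? /tC].
rewrite (eq_esum (b := fun=> ((k * \prod_(a <- h) w_ a / #|stabilizer h|%:R)
    * bridges_weight R g b0)%:E)); last first.
  by move=> b /=; rewrite mem_filter => /andP[_ /tC Cb]; rewrite wE.
rewrite esum_seq ?filter_uniq // => [|b _]; last first.
  rewrite lee_fin; apply: mulr_ge0 (bridges_weight_ge0 _); apply: divr_ge0 => //.
  by apply: mulr_ge0 => //; apply: prodr_ge0 => a _; exact: weight_ge0.
rewrite sum_const_ereal (pE _ ok0 c0) -EFinM; congr (_%:E).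
rewrite size_filter size_map count_map -c0.
rewrite (weight_concatenation F12 walk_h exc_h ok0).
rewrite (perm_symmetry_factor _ (enum_concatenation F12 walk_h exc_h ok0)).
rewrite -sizet natrM /bridges_weight.
have t0 : (size t)%:R != 0 :> R.
  by rewrite pnatr_eq0 size_eq0; apply/eqP => t0; have := (tC b0).2 (conj ok0 c0); rewrite t0.
set F := symmetry_factor _ _ in sizet *.
have F0 : F%:R != 0 :> R.
  rewrite pnatr_eq0 /F; elim: [seq _ | _ <- _] => //= L ls IH.
  by rewrite !muln_eq0 !negb_or IH andbT -lt0n loop_mult_gt0.
by field; rewrite t0 F0.
Qed.

(** Each unordered bridge completes exactly one realization, its own concatenation, so the double
    sum runs once over all unordered bridges. *)
Lemma esum_completions (k : R) (A : set (some_ubridge G))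
    (E : {mset (loop G)}%mset -> seq (walk G)) (M : set {mset (loop G)}%mset) :
  0 <= k ->
  (forall b, bridges_of b -> M (concatenation b) /\ E (concatenation b) = h) ->
  (\esum_(m in M `&` [set m | E m = h])
    \esum_(b in [set b | bridges_of b /\ concatenation b = m] `&` [set b | A (as_ubridge b)])
      (k * bridges_weight R g b)%:E =
   k%:E * \esum_(b in ubridges D1 (@exc_finish G h) (@exc_start G h) `&`
             [set b | A (as_ubridge b)]) (bridges_weight R g b)%:E)%E.
Proof.
move=> k0 bM; rewrite -esumZl //; last first.
  by move=> b; rewrite lee_fin bridges_weight_ge0.
rewrite esum_esum; last first.
  by move=> m b _ _; rewrite lee_fin mulr_ge0 // bridges_weight_ge0.
rewrite (reindex_esum (ubridges D1 (@exc_finish G h) (@exc_start G h) `&`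
             [set b | A (as_ubridge b)]) _ (fun b => (concatenation b, b))) //.
split.
- by move=> b [okb Ab] /=; have [] := bM b okb.
- by move=> b b' _ _ [].
- by move=> [m b] /= [[Mm Em] [[okb cb] Ab]]; exists b; rewrite // cb.
Qed.

End Completions.
End ConditionalLaw.

Theorem proposition1
  (G : digraph) (g : nat)
  (out_degree : forall x : vert G, ([set e : edge G | src e = x] #= `I_g)%card)
  (R : realType)
  (D : subgraph G) (green_fin : finite_green R g D)
  (F1 F2 : {fset vert G})
  (F1_D : forall x, x \in F1 -> sub_vert D x)
  (F2_D : forall x, x \in F2 -> sub_vert D x)
  (F12_disjoint : [disjoint F1 & F2]%fset)
  (ordering : seq (walk G) -> seq (walk G))
  (ordering_perm : forall s, perm_eq (ordering s) s)
  (ordering_inv : forall s t, perm_eq s t -> ordering s = ordering t)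
  (d : measure_display) (T : measurableType d) (P : probability T R)
  (soup : loop G -> T -> nat)
  (soup_poisson : poisson_point_process P (loop_measure R g D) soup)
  (beta : T -> some_ubridge G) :
  let Lbar := fun w : T => crossing_loops F1 F2 (fun L => soup L w) in
  let eta := fun w : T => ordering (excursions F1 F2 (Lbar w)) in
  conditional_distribution P Lbar beta
    (fun m => uniform_on
       (completions F1 D (ordering (excursions F1 F2 m)) m)) ->
  conditional_distribution P eta beta
    (fun h A => ubridge_measure R g (remove_vertices D F1)
       (@exc_finish G h) (@exc_start G h) [set b | A (as_ubridge b)]).
Proof.
move=> Lbar eta Hbeta;  have [mLbar mbeta _] := Hbeta.
pose E m := ordering (excursions F1 F2 m).
pose M := [set m : {mset (loop G)}%mset | forall L, L \in m -> crossing F1 F2 L].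
have countM : countable M.
  exact/countable_msets/(countable_crossing out_degree).
have LbarM w : M (Lbar w) by move=> L; exact: crossing_loops_crossing.
apply: (@conditional_distribution_fibers _ _ _ _ _ _ (E @` M)).
- by move=> C; exact: (mLbar (E @^-1` C)).
- exact: countable_image.
- by move=> w; exists (Lbar w).
- exact: mbeta.
- by move=> h A; exact: ubridge_measure_ge0.
move=> h A _.
pose p m := P (Lbar @^-1` [set m]).
(* Since [eta] is a function of [Lbar], the joint law at [h] is a sum over the realizations with
   excursions [h], to each of which the uniform choice applies. *)
have fibers B : P (eta @^-1` [set h] `&` beta @^-1` B) =
    (\esum_(m in M `&` [set m | E m = h])
       (uniform_on (completions F1 D h m) B * p m))%E.
  rewrite -[eta @^-1` _]/(Lbar @^-1` (E @^-1` [set h])).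
  rewrite (@probability_fibers _ _ _ _ _ _ M) //; apply: eq_esum => m [_ /= Em].
  by rewrite (conditional_distribution1 _ _ Hbeta) -/(E m) Em.
(* For a negligible [h] both sides are 0; this disposes of the lists that do not consist of
   excursions in [D] and of those with [Z] equal to 0. *)
have [ph0|ph0] := eqVneq (P (eta @^-1` [set h])) 0%E.
  rewrite ph0 mule0; apply/eqP; rewrite -measure_le0 -ph0.
  apply: le_measure; rewrite ?inE; last exact: subIsetl.
    by apply: measurableI; [exact: (mLbar (E @^-1` [set h]))|exact: mbeta].
  exact: (mLbar (E @^-1` [set h])).
(* Completions need not be constructed: taking [setT] in the hypothesis shows
   that the realizations without any completion are negligible. *)
have phT : P (eta @^-1` [set h]) = P (eta @^-1` [set h] `&` beta @^-1` setT).
  by rewrite preimage_setT setIT.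
have [m0 [Mm0 Em0 nC0]] : exists m, [/\ M m, E m = h
    & (uniform_on (completions F1 D h m) setT * p m != 0 :> \bar R)%E].
  apply: contrapT => nm; move/eqP: ph0; apply; rewrite phT fibers esum1 //.
  move=> m [Mm Em]; apply: contrapT => /eqP nz; apply: nm; by exists m.
have pm0 : p m0 != 0%E by apply: contraNN nC0 => /eqP ->; rewrite mule0.
(* The realization [m0] of positive probability certifies that [h] consists of genuine excursions in
   [D]. *)
have hE : perm_eq h (excursions F1 F2 m0) by rewrite -Em0 ordering_perm.
have h_valid a : a \in h -> [/\ is_walk a, is_excursion F1 F2 a & in_subgraph D a].
  rewrite (perm_mem hE) => /flatten_mapP[L Lm].
  move=> /(loop_excursionP D F12_disjoint)[wa ea aD]; split => //; apply: aD.
  have m0n0 : m0 != mset0%mset by apply: contraTneq Lm => ->; rewrite in_mset0.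
  exact: (crossing_loops_in_subgraph green_fin F1_D soup_poisson m0n0 Mm0 pm0).
have walk_h a : a \in h -> is_walk a by move=> /h_valid[].
have exc_h a : a \in h -> is_excursion F1 F2 a by move=> /h_valid[].
have h_D a : a \in h -> in_subgraph D a by move=> /h_valid[].
(* As [h] is already in the prescribed order, recovering it up to permutation from a concatenation
   recovers it exactly. *)
have ordering_h : ordering h = h by rewrite -[RHS]Em0; exact: ordering_inv.
have concatenation_ME (b : ubridge G (size h)) : bridges_of F1 D b ->
    M (concatenation b) /\ E (concatenation b) = h.
  move=> okb; split.
    by move=> L /(concatenation_loops F12_disjoint walk_h exc_h h_D okb erefl)[].
  rewrite /E -[RHS]ordering_h; apply: ordering_inv.
  exact: (perm_excursions_concatenation F12_disjoint walk_h exc_h okb).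
(* The event [Lbar = mset0] contains the null event where there are infinitely
   many crossing loops; its probability is not needed. *)
pose k := if h is [::] then fine (p mset0%mset)
  else expR (- fine (loop_measure R g D (crossing F1 F2))).
have k0 : 0 <= k by rewrite /k; case: (h) => *; [exact: fine_ge0|exact: expR_ge0].
have pE (b : ubridge G (size h)) m : bridges_of F1 D b -> concatenation b = m ->
    p m = (k * \prod_(L <- m) weight R g (loop_rep L) /
            (symmetry_factor (@loop_mult G) m)%:R)%:E.
  move=> okb cb; have mP := concatenation_loops F12_disjoint walk_h exc_h h_D okb cb.
  have [h0|h0] := eqVneq h [::].
    have -> : m = mset0%mset.
      apply/msetP => L; rewrite mset0E; apply/mset_eq0P/negP.
      rewrite -cb (perm_mem (enum_concatenation F12_disjoint walk_h exc_h okb)).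
      by move=> /mapP[j _ _]; have := ltn_ord j; rewrite {2}h0.
    rewrite enum_mset0 big_nil /= mulr1 divr1 /k h0 fineK //.
    exact: fin_num_measure.
  have m_n0 : m != mset0%mset.
    apply: contraNneq h0 => m0'; rewrite -size_eq0.
    have := perm_size (perm_excursions_concatenation F12_disjoint walk_h exc_h okb).
    by rewrite cb m0' /excursions enum_mset0 => <-.
  rewrite /p (prob_crossing_loops green_fin F1_D soup_poisson m_n0) //.
  - by rewrite /k; case: (h) h0.
  - by move=> L /mP[].
  - by move=> L /mP[].
pose c := k * \prod_(a <- h) weight R g a / #|stabilizer h|%:R.
have c0 : 0 <= c.
  by apply: divr_ge0 => //; apply: mulr_ge0 => //; apply: prodr_ge0 => a _; exact: weight_ge0.
set X := @exc_finish G h; set Y := @exc_start G h.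
have joint B : P (eta @^-1` [set h] `&` beta @^-1` B) =
    (c%:E * \esum_(b in ubridges (remove_vertices D F1) X Y `&` [set b | B (as_ubridge b)])
       (bridges_weight R g b)%:E)%E.
  rewrite fibers -(esum_completions g B c0 concatenation_ME).
  apply: eq_esum => m _; rewrite (uniform_completions out_degree F12_disjoint walk_h exc_h B k0) //.
  by move=> b okb cb; exact: pE okb cb.
have XY_green j i : (green R g (remove_vertices D F1) (X j) (Y i) < +oo)%E.
  apply: (green_remove_lty green_fin F1 F2_D).
    by have /and5P[] := exc_h _ (mem_tnth j (in_tuple h)).
  by have /and5P[] := exc_h _ (mem_tnth i (in_tuple h)).
set Z := \sum_(s : 'S_(size h)) perm_weight R g (remove_vertices D F1) X Y s.
(* The joint law at [setT]. As the left side is nonzero here, so is [Z], and [c] drops out of the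
   conditional law. *)
have phZ : P (eta @^-1` [set h]) = (c * Z)%:E.
  rewrite phT joint (_ : _ `&` _ = ubridges (remove_vertices D F1) X Y).
    by rewrite esum_bridges_weight.
  by apply/seteqP; split => b //= [].
have Z0 : Z != 0 by apply: contraNneq ph0 => Z0; rewrite phZ Z0 mulr0.
have Z_ge0 : 0 <= Z.
  apply: sumr_ge0 => s _; apply: prodr_ge0 => j _; apply: fine_ge0.
  exact: green_ge0.
rewrite joint phZ ubridge_measureE // -/Z.
rewrite [in RHS](@eq_esum _ _ _ _ (fun b => Z^-1%:E * (bridges_weight R g b)%:E)%E); last first.
  by move=> b _; rewrite -EFinM mulrC.
rewrite esumZl ?invr_ge0 //; last by move=> b; rewrite lee_fin bridges_weight_ge0.
rewrite [RHS]muleC muleA -EFinM; congr (_%:E * _)%E.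
by rewrite mulfK.
Qed.
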